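(* Let $\vec\kappa=\langle\kappa_\alpha:\alpha<\omega_2\rangle$ be a sequence of uncountable cardinals. (1) If $\kappa_\beta<\hat{\mathbb A}(\kappa_\alpha,\omega_1)$ for each $\alpha<\beta<\omega_2$, then $\vec\kappa$ is the cardinal sequence of an LLSP space. (2) If $\vec\kappa$ is the cardinal sequence of an LLSP space, then $\kappa_\beta<\hat{\mathbb I}(\kappa_\alpha,\kappa_\alpha)$ for each $\alpha<\beta<\omega_2$.
   Context: An LLSP space is a locally Lindelöf (every point has a Lindelöf neighborhood), scattered, Hausdorff P-space; a P-space is a space in which the intersection of every countable family of open sets is open. For a topological space $X$ and an ordinal $\alpha$, $I_\alpha(X)$ is the set of isolated points of the subspace $X\setminus\bigcup\{I_\beta(X):\beta<\alpha\}$; $X$ is scattered if $X=\bigcup\{I_\beta(X):\beta<\alpha\}$ for some ordinal $\alpha$. The cardinal sequence of a scattered space $X$ is $\langle |I_\alpha(X)|:\alpha<\delta\rangle$, where $\delta$ is the least ordinal $\gamma$ such that $I_\gamma(X)$ is finite. For a set $S$ and a cardinal $\mu$, $[S]^\mu$ (resp. $[S]^{\le\mu}$) is the set of subsets of $S$ of cardinality $\mu$ (resp. at most $\mu$). For cardinals $\omega\le\lambda\le\kappa$, $\hat{\mathbb A}(\kappa,\lambda)$ is the least cardinal $\mu$ such that for every $\mathcal A\in[[\kappa]^\lambda]^\mu$ there is $\{A_0,A_1\}\in[\mathcal A]^2$ with $|A_0\cap A_1|=\lambda$; and $\hat{\mathbb I}(\kappa,\lambda)$ is the least cardinal $\mu$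 such that for every $\mathcal I\in[[\kappa]^{\le\lambda}]^\mu$ there are $A\in\mathcal I$ and $\mathcal J\in[\mathcal I\setminus\{A\}]^\omega$ with $A\subseteq\bigcup\mathcal J$. *)

(* Defs.v *)
From mathcomp Require Import all_boot all_order.
From mathcomp Require Import wochoice.
From mathcomp Require Import all_classical.
From mathcomp Require Import topology_structure separation_axioms.

Set Implicit Arguments.
Unset Strict Implicit.
Unset Printing Implicit Defensive.

Local Open Scope classical_set_scope.
Local Open Scope card_scope.

(** * Cardinals *)

(** A cardinal is represented by any type of that cardinality, and cardinals
    are compared through [#<=] and [#=].  The definition, rather than [Type],
    keeps all of them in the same universe. *)
Definition cardinal := Type.

Definition card_lt (m n : cardinal) : Prop :=
  ([set: m] #<= [set: n]) /\ ([set: m] #!= [set: n]).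

Definition uncountable (m : cardinal) : Prop := ~ countable [set: m].

Definition is_least_cardinal (P : cardinal -> Prop) (mu : cardinal) : Prop :=
  P mu /\ forall nu : cardinal, P nu -> [set: mu] #<= [set: nu].

Lemma card_leTTP (T U : Type) :
  [set: T] #<= [set: U] <-> exists f : T -> U, injective f.
Proof.
split=> [/card_leP[f]|[f f_inj]].
  exists (fun x => val (f (SigSub (mem_set (I : [set: T] x))))) => x y fxy.
  have : f (SigSub (mem_set (I : [set: T] x))) =
         f (SigSub (mem_set (I : [set: T] y))) by exact: val_inj.
  by move/(@inj _ _ setT f _ _ (mem_set I) (mem_set I))=> /(congr1 val).
have /card_eqPle[_ h] : f @` [set: T] #= [set: T].
  by apply: inj_card_eq => x y _ _; apply: f_inj.
exact: card_le_trans h (card_leT _).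
Qed.

Lemma cantor (T : Type) : ~ ([set: set T] #<= [set: T]).
Proof.
move=> /card_leTTP[f f_inj].
pose D : set T := [set x | exists2 A, f A = x & ~ A x].
have nD : ~ D (f D) by move=> DfD; case: (DfD) => A /f_inj->; apply.
by apply: (nD); exists D.
Qed.

(** Zorn's lemma on the sets of choice functions that differ pairwise at every
    coordinate. *)
Lemma least_in_family (I : Type) (F : I -> Type) (i0 : I) :
  exists i, forall j, [set: F i] #<= [set: F j].
Proof.
pose T := forall i, F i.
pose Q (S : set T) := forall f g, S f -> S g -> f <> g ->
  forall i, f i <> g i.
have [C CQ Ctot|S [QS Smax]] := @Zorn_bigcup T Q.
  move=> f g [A CA Af] [B CB Bg].
  by have [AB|BA] := Ctot _ _ CA CB;
    [apply: (CQ _ CB)|apply: (CQ _ CA)] => //; [exact: AB|exact: BA].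
have [i iS] : exists i, forall a : F i, exists2 f, S f & f i = a.
  apply: contrapT => nS.
  have {nS} h i : exists a : F i, forall f, S f -> f i <> a.
    apply: contrapT => nh; apply: nS; exists i => a; apply: contrapT => na.
    by apply: nh; exists a => f Sf fia; apply: na; exists f.
  pose g : T := fun i => sval (cid (h i)).
  have gP i f : S f -> f i <> g i by move=> Sf; apply: (svalP (cid (h i))).
  have nSg : ~ S g by move=> Sg; apply: (gP i0 g Sg).
  apply: (Smax (S `|` [set g])).
    by split=> [f Sf|/(_ g)]; [left|move=> /(_ (or_intror erefl))].
  move=> f1 f2 [Sf1|->] [Sf2|->] // ne j; [exact: QS|exact: gP|].
  by apply/nesym/gP.
exists i => j; apply/card_leTTP.
exists (fun a => s2val (cid2 (iS a)) j) => a b.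
case: (cid2 (iS a)) (cid2 (iS b)) => f Sf fa [g Sg gb] /= fg.
rewrite -fa -gb; have [->//|ne] := pselect (f = g).
by case: (QS f g Sf Sg ne j).
Qed.

Lemma card_le_total (T U : Type) :
  [set: T] #<= [set: U] \/ [set: U] #<= [set: T].
Proof.
have [[] h] := @least_in_family bool (fun b => if b then T else U) true.
  by left; apply: (h false).
by right; apply: (h true).
Qed.

Lemma least_cardinal_ex (P : cardinal -> Prop) :
  (exists mu, P mu) -> exists mu, is_least_cardinal P mu.
Proof.
move=> [mu0 Pmu0].
pose I := {B : set mu0 | exists2 nu : cardinal, P nu & [set: nu] #= B}.
have I0 : exists2 nu : cardinal, P nu & [set: nu] #= [set: mu0] by exists mu0.
have [[B [mu Pmu muB]] /= Bmin] :=
  @least_in_family I (fun i => set_type (sval i)) (exist _ _ I0).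
exists mu; split=> // nu Pnu.
have muI (C : set mu0) nu' : P nu' -> [set: nu'] #= C -> [set: mu] #<= [set: nu'].
  move=> Pnu' nuC; have hC : exists2 nu : cardinal, P nu & [set: nu] #= C.
    by exists nu'.
  rewrite (card_le_eql muB) (card_le_eqr nuC).
  rewrite -(card_le_eql (card_setT B)) -(card_le_eqr (card_setT C)).
  exact: (Bmin (exist _ C hC)).
have [/card_leTTP[f f_inj]|h] := card_le_total nu mu0.
  apply: (muI (f @` [set: nu])) => //; rewrite card_eq_sym.
  by apply: inj_card_eq => x y _ _; apply: f_inj.
by apply: card_le_trans h; apply: (muI [set: mu0]) => //; exact: card_eqxx.
Qed.

(** * Ordinals *)

(** An ordinal is represented by any well-ordered type of that order type; the
    elements of the type then stand for the smaller ordinals. *)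
Record wellOrder := WellOrder {
  wo_sort :> Type;
  wo_le : rel wo_sort;
  wo_leP : well_order wo_le }.

Definition wo_lt (W : wellOrder) (v w : W) : Prop := wo_le v w /\ v <> w.

Lemma wo_ind_min (W : wellOrder) (A : set W) :
  A !=set0 -> exists2 z, A z & forall x, A x -> wo_le z x.
Proof.
move=> [a Aa]; have [|z [[/asboolP Az zA] _]] := @wo_leP W [pred x | `[< A x >]].
  by exists a; apply/asboolP.
by exists z => // x Ax; apply: zA; apply/asboolP.
Qed.

Lemma wo_anti (W : wellOrder) (x y : W) : wo_le x y -> wo_le y x -> x = y.
Proof.
move=> xy yx; have [|z [[zA _] zU]] := @wo_leP W [pred u | `[< u = x \/ u = y >]].
  by exists x; apply/asboolP; left.
have refl (u : W) : wo_le u u.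
  have [|t [[/asboolP -> ut] _]] := @wo_leP W [pred s | `[< s = u >]].
    by exists u; apply/asboolP.
  by apply: ut; apply/asboolP.
rewrite -(zU x) ?(zU y) //; split; try by apply/asboolP; auto.
  by move=> u /asboolP[]->.
by move=> u /asboolP[]->.
Qed.

Lemma wo_lt_wf (W : wellOrder) : well_founded (@wo_lt W).
Proof.
move=> a; apply: contrapT => na.
have [|z nz zmin] := @wo_ind_min W [set x | ~ Acc (@wo_lt W) x]; first by exists a.
apply: nz; constructor => y [yz ne]; apply: contrapT => ny.
by apply: ne; apply: wo_anti => //; exact: zmin.
Qed.

(** [W] is the initial ordinal of the successor cardinal of [m]. *)
Definition is_initial_succ (m : cardinal) (W : wellOrder) : Prop :=
  ~ ([set: W] #<= [set: m]) /\
  forall w : W, [set v | wo_lt v w] #<= [set: m].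

Lemma initial_succ_ex (m : cardinal) : exists W, is_initial_succ m W.
Proof.
have [R RP] := well_ordering_principle (set m : choiceType).
pose W0 := WellOrder RP.
have [[w0 nw0]|hW0] := pselect (exists w : W0,
  ~ ([set v | wo_lt v w] #<= [set: m])); last first.
  exists W0; split=> [|w]; first exact: cantor.
  by apply: contrapT => nw; apply: hW0; exists w.
have [|w nw wmin] := @wo_ind_min W0 [set w | ~ ([set v | wo_lt v w] #<= [set: m])].
  by exists w0.
pose D := {v : W0 | wo_lt v w}.
pose r : rel D := fun u v => wo_le (sval u) (sval v).
have rP : well_order r.
  move=> A [a Aa].
  have [|z [h Az] zmin] :=
    @wo_ind_min W0 [set v | exists h : wo_lt v w, exist _ v h \in A].
    by case: a Aa => v h Av; exists v, h.
  exists (exist _ z h); split=> [|[u hu] [Au umin]].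
    by split=> // -[u hu] Au; apply: zmin; exists hu.
  apply: eq_exist; apply: wo_anti; last exact: (umin (exist _ z h)).
  by apply: zmin; exists hu.
have le_seg (S : set W0) (B : set D) : (forall u, B u -> S (sval u)) -> B #<= S.
  move=> BS; have /card_eqPle[_ h] : sval @` B #= B.
    by apply: inj_card_eq => -[x hx] [y hy] _ _ /= xy; apply: eq_exist.
  by apply: card_le_trans h (subset_card_le _) => _ [u Bu <-]; apply: BS.
exists (WellOrder rP); split=> [Dm|u].
  apply: nw; apply: card_le_trans Dm.
  have -> : [set v | wo_lt v w] = sval @` [set: D].
    by apply/seteqP; split=> [v h|_ [[v h] _ <-]] //; exists (exist _ v h).
  exact: card_image_le.
apply: (@card_le_trans _ _ _ [set v : W0 | wo_lt v (sval u)]).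
  apply: le_seg => v [vu ne]; split=> // vu'; apply: ne.
  by case: v u vu' {vu} => [v hv] [u hu] /= vu; apply: eq_exist.
apply: contrapT => nu; case: u nu => [u [uw ne]] /= nu.
by apply: ne; apply: wo_anti => //; apply: wmin.
Qed.

Definition omega1 : wellOrder := sval (cid (initial_succ_ex nat)).

Definition aleph1 : cardinal := wo_sort omega1.

Definition omega2 : wellOrder := sval (cid (initial_succ_ex aleph1)).

Lemma omega1P : is_initial_succ nat omega1.
Proof. exact: svalP. Qed.

Lemma omega2P : is_initial_succ aleph1 omega2.
Proof. exact: svalP. Qed.

(** * The cardinals A-hat and I-hat *)

Definition Ahat_prop (kappa lambda mu : cardinal) : Prop :=
  forall A : set (set kappa),
    A #= [set: mu] ->
    (forall a, A a -> a #= [set: lambda]) ->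
    exists a0 a1, [/\ A a0, A a1, a0 <> a1 & a0 `&` a1 #= [set: lambda]].

Definition Ihat_prop (kappa lambda mu : cardinal) : Prop :=
  forall I : set (set kappa),
    I #= [set: mu] ->
    (forall a, I a -> a #<= [set: lambda]) ->
    exists (a : set kappa) (J : set (set kappa)),
      [/\ I a, J `<=` I `\ a, J #= [set: nat] & a `<=` \bigcup_(b in J) b].

(** No family of subsets of [kappa] has cardinality [2 ^ (2 ^ kappa)], so both
    properties hold vacuously for large [mu], and the least [mu] exists. *)
Lemma no_large_family (kappa : cardinal) (A : set (set kappa)) :
  ~ (A #= [set: set (set kappa)]).
Proof.
move=> /card_eqPle[_ h]; apply: (@cantor (set kappa)).
exact: card_le_trans h (card_leT _).
Qed.

Lemma Ahat_ex (kappa lambda : cardinal) :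
  exists mu, is_least_cardinal (Ahat_prop kappa lambda) mu.
Proof.
by apply: least_cardinal_ex; exists (set (set kappa)) => A /no_large_family.
Qed.

Lemma Ihat_ex (kappa lambda : cardinal) :
  exists mu, is_least_cardinal (Ihat_prop kappa lambda) mu.
Proof.
by apply: least_cardinal_ex; exists (set (set kappa)) => I /no_large_family.
Qed.

Definition Ahat (kappa lambda : cardinal) : cardinal :=
  sval (cid (Ahat_ex kappa lambda)).

Definition Ihat (kappa lambda : cardinal) : cardinal :=
  sval (cid (Ihat_ex kappa lambda)).

Lemma AhatP (kappa lambda : cardinal) :
  is_least_cardinal (Ahat_prop kappa lambda) (Ahat kappa lambda).
Proof. exact: svalP. Qed.

Lemma IhatP (kappa lambda : cardinal) :
  is_least_cardinal (Ihat_prop kappa lambda) (Ihat kappa lambda).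
Proof. exact: svalP. Qed.

(** * Cantor-Bendixson levels *)

(** [CB_level X w] is I_alpha(X), where alpha is the ordinal of [w] in [W]. *)
Definition CB_level (X : topologicalType) (W : wellOrder) : W -> set X :=
  Fix (@wo_lt_wf W) (fun=> set X) (fun w level =>
    isolated (~` [set x | exists v (h : wo_lt v w), level v h x])).

Arguments CB_level X {W} w.

Lemma CB_levelE (X : topologicalType) (W : wellOrder) (w : W) :
  CB_level X w = isolated (~` \bigcup_(v in [set v | wo_lt v w]) CB_level X v).
Proof.
rewrite /CB_level Fix_eq; last first.
  by move=> u f g fg; congr (isolated (~` _)); apply/seteqP; split=> x [v [h]];
    exists v, h; rewrite ?fg // -fg.
congr (isolated (~` _)); apply/seteqP; split=> x.
  by move=> [v [h xv]]; exists v.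
by move=> [v h xv]; exists v, h.
Qed.

(** [CB_at X W] is I_alpha(X), where alpha is the order type of [W]. *)
Definition CB_at (X : topologicalType) (W : wellOrder) : set X :=
  isolated (~` \bigcup_(w : W) CB_level X w).

Arguments CB_at X W : clear implicits.

Definition scattered (X : topologicalType) : Prop :=
  exists W : wellOrder, [set: X] = \bigcup_(w : W) CB_level X w.

(** The usual characterization, which also shows that enough ordinals are
    available as well-ordered types. *)
Lemma scatteredP (X : topologicalType) :
  scattered X <-> forall A : set X, A !=set0 -> isolated A !=set0.
Proof.
split=> [[W XW] A [x Ax]|hX].
  have [|w [y [Ay wy]] wmin] := @wo_ind_min W [set w | A `&` CB_level X w !=set0].
    have [w _ wx] : (\bigcup_(w : W) CB_level X w) x by rewrite -XW.
    by exists w, x.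
  exists y; split; first exact: mem_set.
  move: wy; rewrite CB_levelE => -[_ [V yV VE]]; exists V => //.
  apply/seteqP; split=> [z [Vz Az]|_ ->]; last first.
    by split=> //; exact: nbhs_singleton.
  rewrite -VE; split=> // -[v [vw ne] vz]; apply: ne; apply: wo_anti => //.
  by apply: wmin; exists z.
have [W [WX _]] := initial_succ_ex (X : Type).
exists W; apply/esym; rewrite -subTset => x _; apply: contrapT => nx.
have ne (w : W) : CB_level X w !=set0.
  by rewrite CB_levelE; apply: hX; exists x => -[v _ vx]; apply: nx; exists v.
apply: WX; apply/card_leTTP; exists (fun w => sval (cid (ne w))) => v w.
case: (cid (ne v)) (cid (ne w)) => y vy [z wz] /= yz; subst z.
have dis (u u' : W) : CB_level X u y -> CB_level X u' y -> ~ wo_lt u u'.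
  by rewrite [CB_level X u']CB_levelE => uy /isolatedS; apply: contra_not; exists u.
apply: contrapT => vw.
have [|t tvw tmin] := @wo_ind_min W [set t | t = v \/ t = w].
  by exists v; left.
case: tvw => ?; subst t; [apply: (dis v w)|apply: (dis w v)] => //; split=> //.
- by apply: tmin; right.
- by apply: tmin; left.
- by move=> e; apply: vw.
Qed.

(** The cardinal sequence of [X] is [kappa], indexed by the ordinal [W]: the
    least ordinal whose level is finite is the order type of [W]. *)
Definition has_cardinal_sequence (X : topologicalType) (W : wellOrder)
    (kappa : W -> cardinal) : Prop :=
  [/\ finite_set (CB_at X W),
      (forall w : W, infinite_set (CB_level X w)) &
      (forall w : W, CB_level X w #= [set: kappa w])].

(** * LLSP spaces *)

Definition P_space (X : topologicalType) : Prop :=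
  forall F : set (set X), countable F -> (forall U, F U -> open U) ->
    open (\bigcap_(U in F) U).

Definition lindelof (X : topologicalType) (K : set X) : Prop :=
  forall F : set (set X), (forall U, F U -> open U) ->
    K `<=` \bigcup_(U in F) U ->
    exists G : set (set X),
      [/\ G `<=` F, countable G & K `<=` \bigcup_(U in G) U].

Definition locally_lindelof (X : topologicalType) : Prop :=
  forall x : X, exists2 N, nbhs x N & lindelof N.

Definition LLSP (X : topologicalType) : Prop :=
  [/\ locally_lindelof X, scattered X, hausdorff_space X & P_space X].

(* Main.v *)
Require Import Defs.
From HB Require Import structures.
From Stdlib Require Import Inverse_Image.
From mathcomp Require Import all_boot all_order.
From mathcomp Require Import wochoice.
From mathcomp Require Import all_classical.
From mathcomp Require Import topology_structure separation_axioms.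

Set Implicit Arguments.
Unset Strict Implicit.
Unset Printing Implicit Defensive.

Local Open Scope classical_set_scope.
Local Open Scope card_scope.

(** Upper bound.  Let [x] run through level [b] of an LLSP space.  Hausdorff
    and the P-property separate points from Lindelöf sets, as they do for
    compact sets in the classical case, so [x] has a closed neighbourhood
    [K x] that meets level [b] in [x] only.  If [x] is different from countably
    many [y] of level [b], then [K x] minus the union of the [K y] is still a
    neighbourhood of [x], hence meets the lower level [a], which accumulates at
    [x].  So the traces of the [K x] on level [a] are distinct and none is covered by countably
    many others: a family of this kind is what I-hat forbids from its value on.

    Lower bound.  The spaces are described by a rank [rho : X -> W] and a cone
    [U x] at each point, consisting of [x] and of points of smaller rank.  Call
    a set small at rank [w] if countably many cones of rank below [w] cover it,
    and call [A] open if [U x `\` A] is small at [rho x] for each [x] in [A].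
    Small sets form a sigma-ideal, so this is a P-topology.  If the cones are
    clopen and if no [U x] meets a lower level in a small set ([cone_system]),
    the space is LLSP and its levels are the fibres of [rho]
    ([cone_space_LLSP], [cone_space_level]); that cones are Lindelöf follows by
    induction on the rank.

    There is such a system whose levels all have size aleph one and whose
    height is omega two ([thin_tall_system]).  It is built by recursion on the
    level [b].  Fewer than aleph two points lie below [b], so they can be
    listed in type omega one.  One chooses [t_i] ([i] in omega one) outside all
    cones at earlier [t_j] and at earlier points of the list, and cuts down the
    cone at [t_i] to a clopen set that avoids these earlier cones.  The
    resulting sets are disjoint and each cone below [b] meets only countably
    many of them, so any sub-union, with a new point on top, is a new cone.
    The [t_i] must exist even when [b] has countable cofinality, where
    countably many cones could cover everything below [b].  To prevent this,
    each level is coloured with aleph one colours, each used uncountably often,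
    and each cone is made to contain only countably many points of a given
    level and colour: the [i]-th piece avoids the first [i] pairs of a level
    and a colour.

    For an arbitrary sequence [kappa], take one copy of a bottom part of this
    system for each of enough indices, so that level [w] occurs in at most
    [kappa w] copies but, for each [b], some [kappa a] with [a < b] minimal
    indexes copies that reach up to [b].  In the system, level [b] has a
    distinguished point, the apex, that lies in no other cone.  Instead of the
    apices add [kappa b] new points at level [b]: the [i]-th piece of the cone
    at the apex is placed in the [i]-th copy along a set of size aleph one of
    indices, one set for each new point.  These sets come from an almost
    disjoint family on [kappa a] of size [kappa b], which exists below A-hat;
    almost disjointness makes the new cones have small intersections
    ([glued_system]). *)

(** * Well-founded recursion and cardinal arithmetic *)

Lemma wo_trichotomy (W : wellOrder) (v w : W) :
  [\/ wo_lt v w, v = w | wo_lt w v].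
Proof.
have [->|vw] := pselect (v = w); first exact: Or32.
have [|t tvw tmin] := @wo_ind_min W [set t | t = v \/ t = w].
  by exists v; left.
case: tvw => ?; subst t; [apply: Or31|apply: Or33]; split => //.
- by apply: tmin; right.
- by apply: tmin; left.
- exact/nesym.
Qed.

Lemma wo_ltxx (W : wellOrder) (x : W) : ~ wo_lt x x.
Proof. by case. Qed.

Lemma wo_lt_trans (W : wellOrder) (x y z : W) :
  wo_lt x y -> wo_lt y z -> wo_lt x z.
Proof.
move=> [xy nxy] [yz nyz].
have [|t txyz tmin] := @wo_ind_min W [set t | [\/ t = x, t = y | t = z]].
  by exists x; apply: Or31.
have xz : x <> z by move=> xz; subst z; apply: nxy; exact: wo_anti.
split=> //; case: txyz => ?; subst t; first by apply: tmin; apply: Or33.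
  by case: nxy; apply: wo_anti => //; apply: tmin; apply: Or31.
by case: nyz; apply: wo_anti => //; apply: tmin; apply: Or32.
Qed.

Lemma wo_lt_asym (W : wellOrder) (x y : W) : wo_lt x y -> ~ wo_lt y x.
Proof. by move=> xy /(wo_lt_trans xy)/wo_ltxx. Qed.

(** Transfinite recursion where the value at [s] is any solution of a
    specification that depends on the earlier values: a solution only has to
    exist when the earlier values meet their specifications. *)
Lemma wf_choice (S D : Type) (lt : S -> S -> Prop) (d0 : D)
    (Spec : S -> (S -> D) -> D -> Prop) :
  well_founded lt ->
  (forall s g g' d, (forall r, lt r s -> g r = g' r) ->
     Spec s g d -> Spec s g' d) ->
  (forall s g, (forall r, lt r s -> Spec r g (g r)) -> exists d, Spec s g d) ->
  exists g, forall s, Spec s g (g s).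
Proof.
move=> wf loc ex.
pose ext s (h : forall r, lt r s -> D) r :=
  if pselect (lt r s) is left p then h r p else d0.
pose pick (P : set D) := if pselect (P !=set0) is left h then sval (cid h) else d0.
pose F s (h : forall r, lt r s -> D) := pick (Spec s (ext s h)).
pose g := Fix wf (fun=> D) F.
have gE s : g s = pick (Spec s g).
  rewrite {1}/g Fix_eq; last first.
    move=> {}s h h' hh'; congr (F s).
    by apply: functional_extensionality_dep => r;
      apply: functional_extensionality_dep => p; apply: hh'.
  rewrite -/g /F; congr pick; apply/seteqP.
  by split=> d; apply: loc => r rs; rewrite /ext; case: pselect.
exists g => s; elim/(well_founded_ind wf): s => s IH.
by rewrite gE /pick; case: pselect => [h|[]]; [exact: (svalP (cid h))|exact: ex].
Qed.

Lemma card_le_inj (T U : Type) (f : T -> U) (A : set T) (B : set U) :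
  (forall x, A x -> B (f x)) ->
  (forall x y, A x -> A y -> f x = f y -> x = y) -> A #<= B.
Proof.
move=> fAB fI; apply/card_subP; exists (f @` A).
  by apply: inj_card_eq => x y /set_mem Ax /set_mem Ay; exact: fI.
by move=> _ [x Ax <-]; exact: fAB.
Qed.

Lemma card_le_injP (T U : Type) (B : set U) :
  [set: T] #<= B -> exists2 f : T -> U, injective f & forall x, B (f x).
Proof.
rewrite -(card_le_eqr (card_setT B)) => /card_leTTP[f fI].
exists (fun x => val (f x)) => [x y /val_inj/fI//|x].
exact/set_mem/valP.
Qed.

(** Recursion along the order sends each [s] to an element not yet used; there
    is one because the values used so far do not exhaust [M]. *)
Lemma le_of_small_segments (S M : Type) (lt : S -> S -> Prop) :
  well_founded lt -> (forall r s, [\/ lt r s, r = s | lt s r]) ->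
  (forall s, ~ ([set: M] #<= [set r | lt r s])) -> [set: S] #<= [set: M].
Proof.
move=> wf tri small; apply/card_leTTP.
have [[m0]|nM] := pselect (inhabited M); last first.
  have noS (s : S) : False.
    apply: (small s); rewrite (_ : [set: M] = set0) ?card_ge0//.
    by apply/seteqP; split=> // m _; apply: nM; exists.
  by exists (fun s => False_rect M (noS s)) => s; case: (noS s).
have [|s g ex|g gP] := @wf_choice S M lt m0
  (fun s g d => forall r, lt r s -> g r <> d) wf.
- by move=> s g g' d gg' h r rs; rewrite -gg'//; exact: h.
- apply: contrapT => nd; apply: (small s).
  apply: card_le_trans (card_image_le g _); apply: subset_card_le => d _.
  apply: contrapT => nimg; apply: nd; exists d => r rs grd.
  by apply: nimg; exists r.
- exists g => r s grs; case: (tri r s) => // lt_rs; exfalso.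
  + exact: gP lt_rs grs.
  + exact: gP lt_rs (esym grs).
Qed.

(** Hilbert's hotel. *)
Lemma card_option (T : Type) :
  infinite_set [set: T] -> [set: option T] #<= [set: T].
Proof.
move=> /infiniteP/card_le_injP[f fI _]; apply/card_leTTP.
pose h (y : T) := if pselect (exists n, f n = y) is left e
  then f (sval (cid e)).+1 else y.
have hf n : h (f n) = f n.+1.
  rewrite /h; case: pselect => [e|[]]; last by exists n.
  by case: cid => k /= /fI ->.
have hn y : ~ (exists n, f n = y) -> h y = y.
  by rewrite /h; case: pselect.
have hI : injective h.
  move=> x y; have [[n <-]|nx] := pselect (exists n, f n = x);
    have [[k <-]|ny] := pselect (exists n, f n = y).
  - by rewrite !hf => /fI[->].
  - by rewrite hf (hn _ ny) => e; case: ny; exists n.+1.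
  - by rewrite hf (hn _ nx) => e; case: nx; exists k.+1.
  - by rewrite !hn.
have h0 y : h y <> f 0.
  have [[n <-]|ny] := pselect (exists n, f n = y); first by rewrite hf => /fI.
  by rewrite hn// => e; apply: ny; exists 0.
exists (fun o => if o is Some y then h y else f 0) => -[x|] [y|] //=.
- by move=> /hI ->.
- by move=> /h0.
- by move=> /esym/h0.
Qed.

Lemma lex_wf (A B : Type) (ltA : A -> A -> Prop) (ltB : B -> B -> Prop) :
  well_founded ltA -> well_founded ltB ->
  well_founded (fun p q : A * B =>
    ltA p.1 q.1 \/ (p.1 = q.1 /\ ltB p.2 q.2)).
Proof.
move=> wfA wfB [a b]; elim/(well_founded_ind wfA): a b => a IHa b.
elim/(well_founded_ind wfB): b => b IHb.
by constructor=> -[c d] /= [ca|[-> db]]; [exact: IHa|exact: IHb].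
Qed.

(** The initial ordinal of [m], as a relation on a type: a well-order of [m],
    cut at its first element with [m] predecessors if there is one. *)
Lemma initial_order (m : cardinal) :
  exists (S : Type) (lt : S -> S -> Prop),
  [/\ well_founded lt, forall r s, [\/ lt r s, r = s | lt s r],
      forall r s t, lt r s -> lt s t -> lt r t,
      [set: m] #<= [set: S] & forall s, ~ ([set: m] #<= [set r | lt r s])].
Proof.
have [R RP] := well_ordering_principle {classic m}.
pose W := WellOrder RP.
pose big (w : W) := [set: m] #<= [set v : W | wo_lt v w].
pose S := {w : W | ~ big w}.
exists S, (fun u v => wo_lt (sval u) (sval v)); split.
- exact: (wf_inverse_image _ _ _ _ (@wo_lt_wf W)).
- move=> [r hr] [s hs] /=; case: (wo_trichotomy r s) => h;
    [exact: Or31|apply: Or32|exact: Or33].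
  exact: eq_exist.
- by move=> r s t; exact: wo_lt_trans.
- have [nb|] := pselect (forall w, ~ big w).
    by apply/card_leTTP; exists (fun x : m => exist _ (x : W) (nb x)) => x y [].
  move=> /existsNP[w0 /contrapT bw0].
  have [|w bw wmin] := @wo_ind_min W big; first by exists w0.
  have nb v : wo_lt v w -> ~ big v.
    by move=> [vw ne] /wmin wv; apply: ne; exact: wo_anti.
  apply: card_le_trans bw _; rewrite -(card_le_eql (card_setT _)).
  apply/card_leTTP; exists (fun v => exist _ (val v) (nb _ (set_mem (valP v)))).
  by move=> u v [] /val_inj.
- move=> s ms; apply: (svalP s); apply: card_le_trans ms _.
  by apply: (@card_le_inj _ _ sval) => // -[u hu] [v hv] _ _ /= uv; exact: eq_exist.
Qed.

(** Hessenberg's theorem by Gödel's pairing order.  At a least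
    counterexample [m], order the pairs of the initial ordinal of [m] by
    maximum first; the predecessors of a pair lie in the square of a set
    smaller than [m], so [le_of_small_segments] applies. *)
Lemma card_square (T : Type) : infinite_set [set: T] ->
  [set: T * T] #<= [set: T].
Proof.
move=> Tinf; apply: contrapT => nT.
have [m [[minf nm] mmin]] := @least_cardinal_ex
  (fun m => infinite_set [set: m] /\ ~ ([set: m * m] #<= [set: m]))
  (ex_intro _ T (conj Tinf nT)).
have [S [lt [wf tri trans mS small]]] := initial_order m.
have irr s : ~ lt s s by elim/(well_founded_ind wf): s => s IH h; exact: (IH _ h h).
apply: nm; apply: (@card_le_trans _ _ _ [set: S * S]).
  move: mS => /card_leTTP[f fI]; apply/card_leTTP.
  by exists (fun p => (f p.1, f p.2)) => -[a b] [c d] [/fI -> /fI ->].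
(* It remains to embed [S * S] into [m] along the order [lt2]. *)
pose mx (p : S * S) := if pselect (lt p.1 p.2) is left _ then p.2 else p.1.
have mx1 p : ~ lt (mx p) p.1.
  by rewrite /mx; case: pselect => [h h'|_]; [exact: (irr _ (trans _ _ _ h h'))|exact: irr].
have mx2 p : ~ lt (mx p) p.2 by rewrite /mx; case: pselect => [_|//]; exact: irr.
pose key (p : S * S) := (mx p, p).
pose ltS2 (p q : S * S) := lt p.1 q.1 \/ (p.1 = q.1 /\ lt p.2 q.2).
pose lt2 (p q : S * S) :=
  lt (key p).1 (key q).1 \/ ((key p).1 = (key q).1 /\ ltS2 (key p).2 (key q).2).
apply: (@le_of_small_segments _ _ lt2).
- apply: (wf_inverse_image _ _ (fun p q : S * (S * S) => lt p.1 q.1 \/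
    (p.1 = q.1 /\ ltS2 p.2 q.2)) key).
  exact: (lex_wf wf (lex_wf wf wf)).
- move=> [a b] [c d]; rewrite /lt2 /key/= /ltS2/=.
  case: (tri (mx (a, b)) (mx (c, d))) => [h|->|h]; [by apply: Or31; left| |by apply: Or33; left].
  case: (tri a c) => [h|->|h]; [by apply: Or31; right; split=> //; left| |].
    by case: (tri b d) => [h|->|h]; [apply: Or31; right; split=> //; right|
      apply: Or32|apply: Or33; right; split=> //; right].
  by apply: Or33; right; split=> //; left.
move=> p; pose N := [set v | ~ lt (mx p) v].
have segN q : lt2 q p -> N q.1 /\ N q.2.
  move=> qp; have qp' : ~ lt (mx p) (mx q).
    by case: qp => [h h'|[/= -> _]]; [exact: (irr _ (trans _ _ _ h h'))|exact: irr].
  suff h v : ~ lt (mx q) v -> N v by split; apply: h.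
  move=> nv pv; case: (tri (mx p) (mx q)) => // [e|h]; last exact: (nv (trans _ _ _ h pv)).
  by apply: nv; rewrite -e.
have NN : [set q | lt2 q p] #<= [set: N * N].
  rewrite -(card_le_eql (card_setT _)); apply/card_leTTP.
  pose n1 (q : [set q | lt2 q p]) := mem_set (segN _ (set_mem (valP q))).1.
  pose n2 (q : [set q | lt2 q p]) := mem_set (segN _ (set_mem (valP q))).2.
  exists (fun q => (SigSub (n1 q), SigSub (n2 q))) => u v [e1 e2].
  by case: u v e1 e2 => [[a b] hu] [[c d] hv] /= e1 e2; apply: val_inj; rewrite /= e1 e2.
move=> /card_le_trans/(_ NN) mNN.
have [Nfin|Ninf] := pselect (finite_set [set: N]).
  have : finite_set ([set: N] `*` [set: N]) by exact: finite_setX.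
  by rewrite setXTT => /(card_le_finite mNN).
pose D := [set v | lt v (mx p)].
have Nopt : [set: N] #<= [set: option D].
  apply/card_leTTP.
  exists (fun v : N => if pselect (D (val v)) is left h
    then Some (SigSub (mem_set h) : D) else None) => u v.
  case: pselect => hu; case: pselect => hv //; first by move=> [] /val_inj.
  move=> _; have nu := set_mem (valP u); have nv := set_mem (valP v).
  apply: val_inj; case: (tri (val u) (mx p)) => // ->.
  by case: (tri (val v) (mx p)) => // ->.
have [Sfin|Sinf] := pselect (finite_set [set: D]).
  apply: Ninf; apply: card_le_finite Nopt _.
  have -> : [set: option D] = [set None] `|` (Some @` setT).
    by apply/seteqP; split=> // -[x|] _; [right; exists x|left].
  by rewrite finite_setU; split=> //; exact: finite_image.
have NI : ~ ([set: m] #<= [set: N]).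
  move=> mN; apply: (small (mx p)); apply: card_le_trans mN _.
  rewrite -(card_le_eqr (card_setT _)).
  exact: card_le_trans Nopt (card_option Sinf).
apply: (NI); apply: card_le_trans mNN _; apply: contrapT => nNN.
by apply: NI; apply: mmin.
Qed.

(** * The first uncountable cardinal *)

Lemma card_prod_le (T U M : Type) : infinite_set [set: M] ->
  [set: T] #<= [set: M] -> [set: U] #<= [set: M] -> [set: T * U] #<= [set: M].
Proof.
move=> Minf /card_leTTP[f fI] /card_leTTP[g gI].
apply: card_le_trans (card_square Minf); apply/card_leTTP.
by exists (fun p => (f p.1, g p.2)) => -[a b] [c d] [/fI -> /gI ->].
Qed.

Lemma surj_of_le (T U : Type) (t0 : T) : [set: T] #<= [set: U] ->
  exists g : U -> T, forall t, exists u, g u = t.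
Proof.
move=> /card_leTTP[f fI].
exists (fun u => if pselect (exists t, f t = u) is left e then sval (cid e) else t0).
move=> t; exists (f t); case: pselect => [e|[]]; last by exists t.
by apply: fI; exact: (svalP (cid e)).
Qed.

Lemma aleph1_le (M : Type) : uncountable M -> [set: aleph1] #<= [set: M].
Proof.
move=> nM; apply: (le_of_small_segments (@wo_lt_wf omega1)).
  exact: wo_trichotomy.
move=> s /card_le_trans /(_ (omega1P.2 s)); exact: nM.
Qed.

Lemma countable_segment (i : omega1) : countable [set j | wo_lt j i].
Proof. exact: omega1P.2. Qed.

Lemma countable_le_segment (i : omega1) : countable [set j | ~ wo_lt i j].
Proof.
apply: (@sub_countable _ _ _ ([set j | wo_lt j i] `|` [set i])).
  apply: subset_card_le => j ij.
  by case: (wo_trichotomy i j) => // [->|]; [right|left].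
rewrite -bigcup2E; apply: bigcup_countable => // -[|[|k]] _ //=.
exact: countable_segment.
Qed.

Lemma countableU (T : Type) (A B : set T) :
  countable A -> countable B -> countable (A `|` B).
Proof.
by move=> cA cB; rewrite -bigcup2E; apply: bigcup_countable => // -[|[|k]].
Qed.

Lemma uncountable_aleph1 : uncountable aleph1.
Proof. exact: omega1P.1. Qed.

Lemma uncountable_infinite (M : Type) : uncountable M -> infinite_set [set: M].
Proof. by move=> nM /finite_set_countable. Qed.

Lemma countable_preimage_inj (T U : Type) (f : T -> U) (A : set U) :
  injective f -> countable A -> countable (f @^-1` A).
Proof.
move=> fI; apply: sub_countable.
by apply: (@card_le_inj _ _ f) => // x y _ _; exact: fI.
Qed.

Lemma card_eq_aleph1 (T : Type) (A B : set T) :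
  A #= [set: aleph1] -> B `<=` A -> ~ countable B -> B #= [set: aleph1].
Proof.
move=> /card_eqPle[Ale _] BA nB; apply/card_eqPle; split.
  exact: card_le_trans (subset_card_le BA) Ale.
rewrite -(card_le_eqr (card_setT _)); apply: aleph1_le.
by rewrite /uncountable (eq_countable (card_setT _)).
Qed.

(** A bookkeeping function: each pair of a value of [own] and a value of [aux]
    is met uncountably often. *)
Lemma omega1_fibers : exists (own : omega1 -> omega1 * omega1)
    (aux : omega1 -> omega1),
  forall e a, ~ countable [set i | own i = e /\ aux i = a].
Proof.
have inf1 := uncountable_infinite uncountable_aleph1.
have [i0] : exists i0 : omega1, True.
  by have /infinite_setN0[i0 _] := inf1; exists i0.
move=> _; have [h hS] : exists h : omega1 -> (omega1 * omega1) * (omega1 * omega1),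
    forall t, exists u, h u = t.
  apply: surj_of_le; first exact: ((i0, i0), (i0, i0)).
  by do 2?[apply: card_prod_le => //; try exact: card_square].
exists (fun i => (h i).1), (fun i => (h i).2.1) => e a cF.
apply: uncountable_aleph1.
apply: (@sub_countable _ _ _ ((fun i => (h i).2.2) @`
  [set i | (h i).1 = e /\ (h i).2.1 = a])).
  apply: subset_card_le => b _; have [i hi] := hS (e, (a, b)).
  by exists i; rewrite /= hi.
exact: card_le_trans (card_image_le _ _) cF.
Qed.

Lemma uncountable_notin (M : Type) (A : set M) :
  uncountable M -> countable A -> exists x, ~ A x.
Proof.
move=> nM cA; apply: contrapT => nA; apply: nM; apply: sub_countable cA.
by apply: subset_card_le => x _; apply: contrapT => nAx; apply: nA; exists x.
Qed.

Lemma uncountable_diff (M : Type) (A B : set M) :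
  ~ countable A -> countable B -> exists2 x, A x & ~ B x.
Proof.
move=> nA cB; apply: contrapT => nAB; apply: nA; apply: sub_countable cB.
by apply: subset_card_le => x Ax; apply: contrapT => nBx; apply: nAB; exists x.
Qed.

Lemma card_sum_le (T U M : Type) : infinite_set [set: M] ->
  [set: T] #<= [set: M] -> [set: U] #<= [set: M] -> [set: T + U] #<= [set: M].
Proof.
move=> Minf /card_leTTP[f fI] /card_leTTP[g gI].
apply: (@card_le_trans _ _ _ [set: bool * M]).
  apply/card_leTTP.
  exists (fun x => match x with inl t => (true, f t) | inr u => (false, g u) end).
  by move=> [x|x] [y|y] // [] => [/fI|/gI] ->.
apply: card_prod_le => //.
by apply: card_le_trans (countableP setT) _; exact/infiniteP.
Qed.

Lemma card_setU1 (T M : Type) (A : set T) (x : T) : infinite_set [set: M] ->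
  A #<= [set: M] -> A `|` [set x] #<= [set: M].
Proof.
move=> Minf; rewrite -(card_le_eql (card_setT _)) => /card_leTTP[f fI].
apply: card_le_trans (card_option Minf).
rewrite -(card_le_eql (card_setT _)); apply/card_leTTP.
exists (fun y => if pselect (A (val y)) is left h
  then Some (f (SigSub (mem_set h))) else None) => y z.
case: pselect => hy; case: pselect => hz //.
  by move=> [/fI[yz]]; exact: val_inj.
move=> _; apply: val_inj.
have [//|->] := set_mem (valP y); by have [//|->] := set_mem (valP z).
Qed.

Lemma card_le_initial (b : omega2) :
  [set a | ~ wo_lt b a] #<= [set: aleph1].
Proof.
apply: (@card_le_trans _ _ _ ([set a | wo_lt a b] `|` [set b])).
  apply: subset_card_le => a nba.
  by case: (wo_trichotomy a b) => // [|->]; [left|right].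
by apply: card_setU1; [exact: uncountable_infinite uncountable_aleph1|exact: omega2P.2].
Qed.

Lemma card_lt_not_ge (m n : cardinal) :
  ~ ([set: n] #<= [set: m]) -> card_lt m n.
Proof.
move=> nm; split; first by have [] := card_le_total m n.
by apply/negP => /card_eqPle[_].
Qed.

Lemma card_lt_not_le (m n : cardinal) :
  card_lt m n -> ~ ([set: n] #<= [set: m]).
Proof. by move=> [mn /negP ne] nm; apply: ne; exact/card_eqPle. Qed.

(** * Topologies generated by cones *)

Definition small (X : Type) (W : wellOrder) (rho : X -> W) (U : X -> set X)
    (w : W) (A : set X) : Prop :=
  exists C : set X, [/\ countable C, forall c, C c -> wo_lt (rho c) w &
    A `<=` \bigcup_(c in C) U c].

(** [U x] is meant to be a neighbourhood of [x], and the sets [U x `\` B] with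
    [B] small at the rank of [x] a neighbourhood base. *)
Definition cone_open (X : Type) (W : wellOrder) (rho : X -> W)
    (U : X -> set X) (A : set X) : Prop :=
  forall x, A x -> small rho U (rho x) (U x `\` A).

(** [cone_rich] says that each point is a limit of every lower level. *)
Record cone_system (X : Type) (W : wellOrder) (rho : X -> W)
    (U : X -> set X) : Prop := ConeSystem {
  cone_refl : forall x, U x x;
  cone_rank : forall x y, U x y -> y = x \/ wo_lt (rho y) (rho x);
  cone_isopen : forall x, cone_open rho U (U x);
  cone_isclosed : forall x, cone_open rho U (~` U x);
  cone_rich : forall x w, wo_lt w (rho x) ->
    ~ small rho U (rho x) (U x `&` [set y | rho y = w]) }.

Section small_sets.
Variables (X : Type) (W : wellOrder) (rho : X -> W) (U : X -> set X).
Implicit Types (w : W) (A B : set X).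

Lemma sub_small w A B : A `<=` B -> small rho U w B -> small rho U w A.
Proof. by move=> AB [C [cC Cw BC]]; exists C; split=> // x /AB/BC. Qed.

Lemma small0 w : small rho U w set0.
Proof. by exists set0; split. Qed.

Lemma small_bigcup (I : Type) (D : set I) (F : I -> set X) w :
  countable D -> (forall i, D i -> small rho U w (F i)) ->
  small rho U w (\bigcup_(i in D) F i).
Proof.
move=> cD sF; pose C i := if pselect (D i) is left h then sval (cid (sF i h)) else set0.
have CP i : D i -> [/\ countable (C i), forall c, C i c -> wo_lt (rho c) w &
    F i `<=` \bigcup_(c in C i) U c].
  by rewrite /C; case: pselect => // h _; exact: (svalP (cid (sF i h))).
exists (\bigcup_(i in D) C i); split.
- by apply: bigcup_countable => // i /CP[].
- by move=> c [i /CP[_ h _] /h].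
- move=> x [i Di /(let: And3 _ _ h := CP i Di in h)[c Cc Ucx]].
  by exists c => //; exists i.
Qed.

Lemma small_cone w x : wo_lt (rho x) w -> small rho U w (U x).
Proof.
move=> xw; exists [set x]; split=> // [c ->//|y Uxy]; by exists x.
Qed.

Lemma small_le v w A : wo_lt v w -> small rho U v A -> small rho U w A.
Proof.
by move=> vw [C [cC Cv AC]]; exists C; split=> // c /Cv/wo_lt_trans; exact.
Qed.

Lemma cone_openT : cone_open rho U setT.
Proof. by move=> x _; rewrite setDT; exact: small0. Qed.

Lemma cone_open_bigcup (I : Type) (D : set I) (F : I -> set X) :
  (forall i, D i -> cone_open rho U (F i)) ->
  cone_open rho U (\bigcup_(i in D) F i).
Proof.
move=> oF x [i Di Fix]; apply: sub_small (oF i Di x Fix).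
by move=> y [Uxy nFy]; split=> // Fiy; apply: nFy; exists i.
Qed.

(** The reason why the topology makes a P-space: smallness is preserved by
    countable unions. *)
Lemma cone_open_bigcap (I : Type) (D : set I) (F : I -> set X) :
  countable D -> (forall i, D i -> cone_open rho U (F i)) ->
  cone_open rho U (\bigcap_(i in D) F i).
Proof.
move=> cD oF x Fx.
apply: (@sub_small _ _ (\bigcup_(i in D) (U x `\` F i))).
  move=> y [Uxy /existsNP[i /not_implyP[Di nFi]]]; by exists i.
by apply: small_bigcup => // i Di; apply: oF => //; exact: Fx.
Qed.

Lemma cone_openI A B :
  cone_open rho U A -> cone_open rho U B -> cone_open rho U (A `&` B).
Proof.
by move=> oA oB; rewrite -bigcap2E; apply: cone_open_bigcap => // -[|[|k]] _ //=;
  exact: cone_openT.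
Qed.

Lemma cone_openU A B :
  cone_open rho U A -> cone_open rho U B -> cone_open rho U (A `|` B).
Proof.
move=> oA oB; rewrite -bigcup2E; apply: cone_open_bigcup => -[|[|k]] _ //=.
Qed.

End small_sets.

(** A copy of [X], with parameters that let the topology be inferred. *)
Definition cone_space (X : Type) (W : wellOrder) (rho : X -> W)
  (U : X -> set X) : Type := X.

Section cone_topology.
Variables (X : Type) (W : wellOrder) (rho : X -> W) (U : X -> set X).

Local Notation S := (cone_space rho U).

HB.instance Definition _ := gen_eqMixin S.
HB.instance Definition _ := gen_choiceMixin S.

Lemma cone_open_setI : setI_closed (cone_open rho U : set_system S).
Proof. exact: cone_openI. Qed.

Lemma cone_open_bigcup_set (I : Type) (f : I -> set S) :
  (forall i, cone_open rho U (f i)) -> cone_open rho U (\bigcup_i f i).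
Proof. by move=> h; exact: cone_open_bigcup. Qed.

HB.instance Definition _ := @isOpenTopological.Build S (cone_open rho U)
  (cone_openT rho U) cone_open_setI cone_open_bigcup_set.

Lemma cone_space_P : P_space S.
Proof. by move=> F cF oF; exact: cone_open_bigcap. Qed.

Hypothesis sys : cone_system rho U.

Lemma cone_nbhs (x : S) : nbhs x (U x : set S).
Proof.
rewrite nbhsE; exists (U x) => //; split; last exact: cone_refl sys x.
exact: cone_isopen sys x.
Qed.

Lemma cone_nbhs_small (x : S) (A : set S) :
  nbhs x A -> small rho U (rho x) (U x `\` A).
Proof.
rewrite nbhsE => -[B [oB Bx] BA]; apply: sub_small (oB x Bx).
by move=> y [Uxy nAy]; split=> // /BA.
Qed.

Lemma cone_space_hausdorff : hausdorff_space S.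
Proof.
rewrite open_hausdorff => x y xy.
wlog nyx : x y xy / ~ U x y.
  move=> H; have [Uxy|/H] := pselect (U x y); last exact.
  have [Uyx|nyx] := pselect (U y x); last first.
    have [|[A B] /= [yA xB] [oA oB AB]] := H y x _ nyx; first by rewrite eq_sym.
    by exists (B, A) => //; split=> //; rewrite setIC.
  have [e|yx] := cone_rank sys Uxy; first by rewrite e eqxx in xy.
  have [e|/wo_lt_asym//] := cone_rank sys Uyx; by rewrite e eqxx in xy.
exists (U x, ~` U x) => /=.
  by split; apply/mem_set => //; exact: cone_refl sys x.
split; [exact: cone_isopen sys x|exact: cone_isclosed sys x|].
by apply/eqP; exact: setICr.
Qed.

(** One member of a cover contains the top [x] and leaves a small part of
    [U x]; by induction the countably many lower cones that cover this part
    are Lindelöf. *)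
Lemma cone_lindelof (x : S) : lindelof (U x : set S).
Proof.
elim/(well_founded_ind (wf_inverse_image _ _ _ rho (@wo_lt_wf W))): x => x IH.
move=> F oF covF; have [V FV Vx] := covF x (cone_refl sys x).
have [C [cC Cx UC]] := oF V FV x Vx.
have h c : exists G : set (set S), C c ->
    [/\ G `<=` F, countable G & U x `&` U c `<=` \bigcup_(B in G) B].
  have [Cc|nCc] := pselect (C c); last by exists set0.
  have [||G [GF cG UG]] := IH c (Cx c Cc) (F `|` [set ~` U x : set S]).
  - by move=> B [/oF//|->]; exact: cone_isclosed sys x.
  - move=> y Ucy; have [Uxy|nUxy] := pselect (U x y).
      by have [B FB By] := covF y Uxy; exists B => //; left.
    by exists (~` U x) => //; right.
  exists (G `&` F) => _; split; first by move=> B [].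
    by apply: sub_countable cG; apply: subset_card_le => B [].
  move=> y [Uxy /UG[B GB By]]; exists B => //; split=> //.
  by case: (GF B GB) => // e; rewrite e in By.
pose G c := sval (cid (h c)).
exists ([set V] `|` \bigcup_(c in C) G c); split.
- by move=> B [->//|[c Cc]]; case: (svalP (cid (h c)) Cc) => + _ _; apply.
- apply: countableU => //; apply: bigcup_countable => // c Cc.
  by case: (svalP (cid (h c)) Cc).
- move=> y Uxy; have [Vy|nVy] := pselect (V y); first by exists V => //; left.
  have [c Cc Ucy] := UC y (conj Uxy nVy).
  case: (svalP (cid (h c)) Cc) => _ _ /(_ y (conj Uxy Ucy))[B GB By].
  by exists B => //; right; exists c.
Qed.

(** Points of rank [w] are isolated once lower ranks are removed, by their
    cones; [cone_rich] keeps points of higher rank from being isolated. *)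
Lemma cone_space_level (w : W) :
  CB_level S w = [set x : S | rho x = w].
Proof.
elim/(well_founded_ind (@wo_lt_wf W)): w => w IH.
rewrite CB_levelE.
have -> : \bigcup_(v in [set v | wo_lt v w]) CB_level S v =
    [set x : S | wo_lt (rho x) w].
  apply/seteqP; split=> [x [v /= vw]|x /= xw]; first by rewrite IH//= => ->.
  by exists (rho x) => //; rewrite IH.
apply/seteqP; split=> x.
  move=> [/set_mem /= nxw [V Vx VE]]; case: (wo_trichotomy w (rho x)) => // wx.
  case: (cone_rich sys wx); apply: sub_small (cone_nbhs_small Vx).
  move=> y [Uxy /= yw]; split=> // Vy.
  have : (V `&` ~` [set x : S | wo_lt (rho x) w]) y.
    by split=> //=; rewrite yw; exact: wo_ltxx.
  by rewrite VE => /= e; rewrite -e yw in wx; exact: wo_ltxx wx.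
move=> /= xw; split; first by apply/mem_set; rewrite /= xw; exact: wo_ltxx.
exists (U x); first exact: cone_nbhs.
apply/seteqP; split=> [y [Uxy nyw]|_ ->].
  by have [->//|] := cone_rank sys Uxy; rewrite xw.
by split; [exact: cone_refl sys x|rewrite /= xw; exact: wo_ltxx].
Qed.

Lemma cone_space_cover : \bigcup_(w : W) CB_level S w = setT.
Proof.
rewrite -subTset => x _; exists (rho x) => //.
by rewrite cone_space_level.
Qed.

Lemma cone_space_LLSP : LLSP S.
Proof.
split; last exact: cone_space_P.
- by move=> x; exists (U x); [exact: cone_nbhs|exact: cone_lindelof].
- by exists W; rewrite cone_space_cover.
- exact: cone_space_hausdorff.
Qed.

Lemma cone_space_cardinal_sequence (kappa : W -> cardinal) :
  (forall w, infinite_set [set: kappa w]) ->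
  (forall w, [set x | rho x = w] #= [set: kappa w]) ->
  has_cardinal_sequence S kappa.
Proof.
move=> kinf cardE; split.
- rewrite /CB_at cone_space_cover setCT (_ : isolated set0 = set0) //.
  by apply/seteqP; split=> // x /isolatedS.
- by move=> w; rewrite cone_space_level (eq_finite_set (cardE w)); exact: kinf.
- by move=> w; rewrite cone_space_level; exact: cardE.
Qed.

End cone_topology.

(** * A system of cones of width aleph one and height omega two *)

Lemma small_ext (X : Type) (W : wellOrder) (rho : X -> W) (U U' : X -> set X)
    (w : W) (A : set X) :
  (forall c, wo_lt (rho c) w -> U c = U' c) ->
  small rho U w A -> small rho U' w A.
Proof.
move=> UU' [C [cC Cw AC]]; exists C; split=> // x /AC[c Cc Ucx].
by exists c => //; rewrite -UU'//; exact: Cw.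
Qed.

(** A point is a level, a colour and a label that makes each colour occur
    uncountably often in each level. *)
Definition site : Type := (omega2 * (omega1 * omega1))%type.

Definition level (x : site) : omega2 := x.1.

(** A colour class of a level. *)
Definition hue (x : site) : omega2 * omega1 := (x.1, x.2.1).

Section ladders.
Variables (own : omega1 -> omega1 * omega1) (apex : omega1 * omega1).

(** The pieces [K b i] of level [b] are shared between its points: point [x]
    takes those with [own i = x.2].  Thus distinct points of a level have
    disjoint cones, and one sequence of pieces settles the whole level. *)
Definition ladder_cone (K : omega2 -> omega1 -> set site) (x : site) :
    set site :=
  [set y | y = x \/
    (wo_lt (level y) (level x) /\ exists2 i, own i = x.2 & K x.1 i y)].

(** What the pieces [d] of level [b] must satisfy, given those of the lower
    levels.  The first six clauses make the cones of level [b] clopen and rich.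
    [ladder_apex] keeps the points [(a, apex)] out of all other cones, so that
    the pieces of their cones are almost disjoint for different levels.
    [ladder_hue] bounds each cone on each colour class, which is why points
    outside countably many cones exist at the next levels. *)
Record ladder (b : omega2) (K : omega2 -> omega1 -> set site)
    (d : omega1 -> set site) : Prop := Ladder {
  ladder_small : forall i, small level (ladder_cone K) b (d i);
  ladder_open : forall i x, wo_lt (level x) b -> d i x ->
    small level (ladder_cone K) (level x) (ladder_cone K x `\` d i);
  ladder_closed : forall i x, wo_lt (level x) b -> ~ d i x ->
    small level (ladder_cone K) (level x) (ladder_cone K x `&` d i);
  ladder_disj : forall i j x, d i x -> d j x -> i = j;
  ladder_locally_countable : forall x, wo_lt (level x) b ->
    countable [set i | d i `&` ladder_cone K x !=set0];
  ladder_rich : forall a e, wo_lt a b ->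
    ~ countable [set i | own i = e /\ exists2 x, d i x & level x = a];
  ladder_apex : forall i a, ~ d i (a, apex);
  ladder_hue : forall h, countable [set x | hue x = h /\ exists i, d i x] }.

Section properties.
Variable K : omega2 -> omega1 -> set site.
Local Notation U := (ladder_cone K).

Lemma ladder_cone_rank x y : U x y -> y = x \/ wo_lt (level y) (level x).
Proof. by case=> [|[]]; [left|right]. Qed.

Lemma ladder_cone_isopen z : ladder (level z) K (K (level z)) ->
  cone_open level U (U z).
Proof.
move=> L x [->|[xz [i iz Kx]]].
  by rewrite setDv; exact: small0.
apply: sub_small (ladder_open L xz Kx) => y [Uxy nUzy]; split=> // Ky; apply: nUzy.
right; split; last by exists i.
by have [->//|/wo_lt_trans] := ladder_cone_rank Uxy; apply.
Qed.

(** For [x] below [z], only countably many pieces of [U z] meet [U x], and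
    each meets it in a small set.  For [x] at the level of [z] the cones are
    disjoint, and for [x] above it [U z] itself is small. *)
Lemma ladder_cone_isclosed z : ladder (level z) K (K (level z)) ->
  cone_open level U (~` U z).
Proof.
move=> L x nUzx; rewrite setDE setCK.
have nzx : wo_lt (level x) (level z) \/ level x = level z -> ~ U x z.
  move=> h Uxz; have [e|zx] := ladder_cone_rank Uxz.
    by apply: nUzx; rewrite e; left.
  by case: h => [/wo_lt_asym//|e]; rewrite e in zx; exact: wo_ltxx zx.
case: (wo_trichotomy (level x) (level z)) => [xz|xz|zx].
- apply: (@sub_small _ _ _ _ _ _ (\bigcup_(i in [set i | own i = z.2 /\
      K (level z) i `&` U x !=set0]) (U x `&` K (level z) i))).
    move=> y [Uxy [e|[yz [i iz Ky]]]].
      by case: nzx; [left|rewrite -e].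
    by exists i => //; split=> //; exists y.
  apply: small_bigcup.
    by apply: sub_countable (ladder_locally_countable L xz); apply: subset_card_le => i [].
  move=> i [iz _]; apply: (ladder_closed L xz) => Kx; apply: nUzx; right.
  by split=> //; exists i.
- rewrite (_ : _ `&` _ = set0); first exact: small0.
  apply/seteqP; split=> // y [Uxy Uzy].
  case: Uxy => [e|[yx [i ix Kiy]]]; first by apply: nUzx; rewrite -e.
  case: Uzy => [e|[yz [j jz Kjy]]]; first by case: (nzx); [right|rewrite -e; right; split=> //; exists i].
  have xz1 : x.1 = z.1 by [].
  rewrite xz1 in Kiy; have ij := ladder_disj L Kiy Kjy.
  apply: nUzx; left; rewrite [x]surjective_pairing [z]surjective_pairing xz1.
  by rewrite -ix -jz ij.
- by apply: sub_small (small_cone U zx) => y [].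
Qed.

(** Countably many lower cones meet countably many pieces, whereas uncountably
    many pieces of [U x] reach level [w]. *)
Lemma ladder_cone_rich x w : ladder (level x) K (K (level x)) ->
  wo_lt w (level x) ->
  ~ small level U (level x) (U x `&` [set y | level y = w]).
Proof.
move=> L wx [C [cC Cx UC]].
have cI : countable (\bigcup_(c in C) [set i | K (level x) i `&` U c !=set0]).
  by apply: bigcup_countable => // c /Cx; exact: (ladder_locally_countable L).
have [i [ix [y Ky yw]] nI] := uncountable_diff (ladder_rich (e := x.2) L wx) cI.
have [|c Cc Ucy] := UC y; last by apply: nI; exists c => //; exists y.
by split=> //; right; rewrite yw; split=> //; exists i.
Qed.

Lemma ladder_cone_hue x h : ladder (level x) K (K (level x)) ->
  countable (U x `&` [set y | hue y = h]).
Proof.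
move=> L; apply: (@sub_countable _ _ _
  ([set x] `|` [set y | hue y = h /\ exists i, K (level x) i y])).
  apply: subset_card_le => y [[->|[_ [i _ Kiy]]] /= yh]; first by left.
  by right; split=> //; exists i.
by apply: countableU => //; exact: (ladder_hue L).
Qed.

End properties.

(** The form of locality that [wf_choice] asks for. *)
Lemma ladder_local b (K K' : omega2 -> omega1 -> set site) d :
  (forall a, wo_lt a b -> K a = K' a) -> ladder b K d -> ladder b K' d.
Proof.
move=> KK'; have UU' x : wo_lt (level x) b -> ladder_cone K x = ladder_cone K' x.
  by move=> xb; rewrite /ladder_cone KK'.
have sm w A : ~ wo_lt b w ->
    small level (ladder_cone K) w A -> small level (ladder_cone K') w A.
  move=> bw; apply: small_ext => c cw; apply: UU'.
  case: (wo_trichotomy b w) => // [->//|]; exact: wo_lt_trans.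
case=> L1 L2 L3 L4 L5 L6 L7 L8; split => //.
- by move=> i; apply: sm (L1 i); exact: wo_ltxx.
- by move=> i x xb dx; rewrite -UU'//; apply: sm (L2 i x xb dx); exact: wo_lt_asym.
- by move=> i x xb dx; rewrite -UU'//; apply: sm (L3 i x xb dx); exact: wo_lt_asym.
- by move=> x xb; rewrite -UU'//; exact: L5.
Qed.

Lemma card_sites_below (b : omega2) :
  [set: {x : site | wo_lt (level x) b}] #<= [set: omega1].
Proof.
have inf1 := uncountable_infinite uncountable_aleph1.
apply: (@card_le_trans _ _ _ [set: [set a | wo_lt a b] * (omega1 * omega1)]).
  apply/card_leTTP.
  pose g (x : {x : site | wo_lt (level x) b}) : [set a | wo_lt a b] :=
    SigSub (mem_set (svalP x : [set a | wo_lt a b] (level (sval x)))).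
  exists (fun x => (g x, (sval x).2)) => -[[a e] ha] [[a' e'] ha'] /= [ea ee].
  by apply: eq_exist; rewrite ea ee.
apply: card_prod_le => //; last exact: card_square.
by rewrite (card_le_eql (card_setT _)); exact: (omega2P.2 b).
Qed.

Variable aux : omega1 -> omega1.
Hypothesis fibers : forall e a, ~ countable [set i | own i = e /\ aux i = a].

(** The recursion step, itself a recursion along omega one.  The sequence [q]
    lists the points below [b].  The point [t i] is chosen outside the cones at
    [t j] and [q j] and outside the colour class of [q j], for all [j] before
    [i], at the level prescribed by [aux i].  The [i]-th piece is the cone at
    [t i] without the cones at the points of the countable set [E i]. *)
Lemma ladder_ex b (K : omega2 -> omega1 -> set site) :
  (forall a, wo_lt a b -> ladder a K (K a)) -> exists d, ladder b K d.
Proof.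
move=> L; have [[a0 a0b]|nb] := pselect (exists a, wo_lt a b); last first.
  exists (fun=> set0); split=> //.
  - by move=> i; exact: small0.
  - by move=> i x xb; case: nb; exists (level x).
  - by move=> x xb; case: nb; exists (level x).
  - by move=> a e ab; case: nb; exists a.
  - by move=> i a [].
  - move=> h; apply: sub_countable (countable0 site).
    by apply: subset_card_le => x [_ []].
pose U := ladder_cone K.
have [q' q'S] : exists q' : omega1 -> {x : site | wo_lt (level x) b},
    forall x, exists j, q' j = x.
  by apply: surj_of_le (card_sites_below b); exists (a0, apex).
pose q j := sval (q' j).
have qb j : wo_lt (level (q j)) b by exact: (svalP (q' j)).
have qS x : wo_lt (level x) b -> exists j, q j = x.
  by move=> xb; have [j qj] := q'S (exist _ x xb); exists j; rewrite /q qj.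
pose R i (t : omega1 -> site) x := [/\ level x = level (q (aux i)), x.2 <> apex &
  forall j, wo_lt j i -> [/\ ~ U (t j) x, ~ U (q j) x & hue x <> hue (q j)]].
have [t tR] : exists t, forall i, R i t (t i).
  apply: (wf_choice (q (aux apex.1)) (@wo_lt_wf omega1)).
    move=> i t t' x tt' [h1 h2 h3]; split=> // j ji.
    by rewrite -tt'//; exact: h3.
  move=> i t tR; pose a := level (q (aux i)).
  have tb j : wo_lt j i -> wo_lt (level (t j)) b by move=> /tR[-> _ _].
  (* A colour [c] of level [a] not forbidden so far has uncountably many
     points, of which the earlier cones contain only countably many. *)
  have [c nc] := uncountable_notin uncountable_aleph1
    (card_le_trans (card_image_le (fun j => (q j).2.1) _) (countable_segment i)).
  pose B := [set (a, apex)] `|` \bigcup_(j in [set j | wo_lt j i])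
    ((U (t j) `&` [set y | hue y = (a, c)]) `|`
     (U (q j) `&` [set y | hue y = (a, c)])).
  have cB : countable B.
    apply: countableU => //; apply: bigcup_countable => [|j ji].
      exact: countable_segment.
    by apply: countableU; apply: ladder_cone_hue; apply: L => //; exact: tb.
  have [z nz] : exists z, ~ ((fun z => (a, (c, z))) @^-1` B) z.
    apply: uncountable_notin uncountable_aleph1 _.
    by apply: countable_preimage_inj cB => z z' [].
  exists (a, (c, z)); split=> //= [e|j ji]; first by apply: nz; left; rewrite /= e.
  split=> [Ut|Uq|[_ cq]].
  - by apply: nz; right; exists j => //; left.
  - by apply: nz; right; exists j => //; right.
  - by apply: nc; exists j.
have tb i : wo_lt (level (t i)) b by have [-> _ _] := tR i.
(* Besides the earlier cones, remove the cones at all points of the colour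
   classes of earlier [q j]; [U (t i)] has only countably many of these. *)
pose E i := [set z | exists2 j, wo_lt j i &
  [\/ z = t j, z = q j | [/\ U (t i) z, z <> t i & hue z = hue (q j)]]].
have Eb i z : E i z -> wo_lt (level z) b.
  move=> [j ji [->//|->//|[/ladder_cone_rank[->//|/wo_lt_trans zt] _ _]]].
  exact: zt.
have cE i : countable (E i).
  apply: (@sub_countable _ _ _ (\bigcup_(j in [set j | wo_lt j i])
    ([set t j] `|` ([set q j] `|` (U (t i) `&` [set z | hue z = hue (q j)]))))).
    apply: subset_card_le => z [j ji [->|->|[Uz nz hz]]]; exists j => //.
    - by left.
    - by right; left.
    - by right; right.
  apply: bigcup_countable => [|j ji]; first exact: countable_segment.
  by do 2?[apply: countableU => //]; apply: ladder_cone_hue; exact: L.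
pose d i := U (t i) `&` \bigcap_(z in E i) ~` U z.
have dopen i : cone_open level U (d i).
  apply: cone_openI; first by apply: ladder_cone_isopen; exact: L.
  apply: cone_open_bigcap => // z /Eb zb.
  by apply: ladder_cone_isclosed; exact: L.
have dclosed i : cone_open level U (~` d i).
  rewrite setCI setC_bigcap; apply: cone_openU.
    by apply: ladder_cone_isclosed; exact: L.
  apply: cone_open_bigcup => z /Eb zb; rewrite setCK.
  by apply: ladder_cone_isopen; exact: L.
have tE i z : E i z -> ~ U z (t i).
  have [_ _ tRi] := tR i; case=> j /tRi[nt nq nh] [->//|->//|[Uz nz _]] Uzt.
  have [//|zt] := ladder_cone_rank Uz.
  by have [/esym//|/wo_lt_asym] := ladder_cone_rank Uzt.
have td i : d i (t i) by split; [left|move=> z /tE].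
have dt i j x : wo_lt j i -> d i x -> ~ d j x.
  by move=> ji [_ dx] [Ux _]; apply: (dx (t j)) => //; exists j => //; exact: Or31.
exists d; split.
- by move=> i; apply: sub_small (small_cone U (tb i)) => x [].
- by move=> i x _ dx; exact: dopen.
- by move=> i x _ /(dclosed i); rewrite setDE setCK.
- move=> i j x dix djx; case: (wo_trichotomy i j) => // ij; exfalso.
    exact: dt ij djx dix.
  exact: dt ij dix djx.
- move=> x /qS[j <-]; apply: sub_countable (countable_le_segment j).
  apply: subset_card_le => i [y [[_ dy] Uy]] /= ji.
  by apply: (dy (q j)) => //; exists j => //; exact: Or32.
- move=> a e ab cI; have [j qj] := qS (a, apex) ab.
  apply: (fibers (e := e) (a := j)); apply: sub_countable cI.
  apply: subset_card_le => i [ie ij]; split=> //; exists (t i) => //.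
  by have [-> _ _] := tR i; rewrite ij qj.
- move=> i a [Ua _]; case: Ua => [e|[_ [k _ Kk]]].
    by have [_ h _] := tR i; apply: h; rewrite -e.
  exact: (ladder_apex (L _ (tb i)) Kk).
- move=> h; set H := [set x | _].
  have [[x0 [x0h [i0 [Ux0 _]]]]|H0] := pselect (H !=set0); last first.
    rewrite (_ : H = set0) ?countable0//; apply/seteqP; split=> // x Hx.
    by apply: H0; exists x.
  (* Pieces after the [k]-th avoid the colour class of [q k]. *)
  have [k qk] : exists k, q k = x0.
    apply: qS; have [->//|/wo_lt_trans] := ladder_cone_rank Ux0; apply; exact: tb.
  apply: (@sub_countable _ _ _ (\bigcup_(i in [set i | ~ wo_lt k i])
    (U (t i) `&` [set y | hue y = h]))).
    apply: subset_card_le => x [xh [i [Ux dx]]]; exists i => //= ki.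
    have [xt|xt] := pselect (x = t i).
      have [_ _ /(_ k ki)[_ _]] := tR i; apply.
      by rewrite -xt qk xh.
    apply: (dx x); last by left.
    by exists k => //; apply: Or33; split=> //; rewrite qk xh.
  apply: bigcup_countable => [|i _]; first exact: countable_le_segment.
  by apply: ladder_cone_hue; exact: L.
Qed.

End ladders.

(** The sets [P b i] are the pieces of the cone at the apex of level [b],
    without the apex; pieces that belong to other points are replaced with the
    empty set. *)
Lemma thin_tall_system : exists (U : site -> set site)
    (P : omega2 -> omega1 -> set site),
  [/\ cone_system level U,
      forall b i, small level U b (P b i),
      forall b i, cone_open level U (P b i) /\ cone_open level U (~` P b i),
      forall a b, wo_lt a b ->
        ~ countable [set i | exists2 x, P b i x & level x = a] &
      forall a b, wo_lt a b ->
        countable [set i | exists j, P a i `&` P b j !=set0]].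
Proof.
have [own [aux fibers]] := omega1_fibers.
have [i0 _] := uncountable_notin uncountable_aleph1 (countable0 omega1).
pose apex : omega1 * omega1 := (i0, i0).
have [K L] := wf_choice (fun=> set0) (@wo_lt_wf omega2)
  (@ladder_local own apex) (@ladder_ex own apex aux fibers).
pose U := ladder_cone own K.
pose P b i := [set x | own i = apex /\ K b i x].
exists U, P; split.
- split=> [x|x y|x|x|x w wx]; first by left.
  + exact: ladder_cone_rank.
  + exact: (ladder_cone_isopen (L _)).
  + exact: (ladder_cone_isclosed (L _)).
  + exact: (ladder_cone_rich (L _)).
- move=> b i; apply: sub_small (ladder_small (L b) i) => x; by case.
- have Kb b i x : K b i x -> wo_lt (level x) b.
    move=> Kx; have [C [_ Cb /(_ x Kx)[c Cc Ucx]]] := ladder_small (L b) i.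
    have [->|/wo_lt_trans] := ladder_cone_rank Ucx; first exact: Cb.
    by apply; exact: Cb.
  move=> b i; split=> x.
    move=> [io Kx]; apply: sub_small (ladder_open (L b) (Kb _ _ _ Kx) Kx).
    by move=> y [Uxy nPy]; split=> // Ky; apply: nPy.
  move=> nPx; rewrite setDE setCK.
  have [io|nio] := pselect (own i = apex); last first.
    by apply: sub_small (small0 _ _ _) => y [_ []].
  case: (wo_trichotomy (level x) b) => [xb|->|bx].
  + apply: sub_small (ladder_closed (L b) xb (i := i) _) => [y [Uxy []]//|Kx].
    exact: nPx.
  + by apply: sub_small (ladder_small (L b) i) => y [_ []].
  + apply: sub_small (small_le bx (ladder_small (L b) i)) => y [_ []]; by [].
- move=> a b ab cI; apply: (ladder_rich (e := apex) (L b) ab); apply: sub_countable cI.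
  by apply: subset_card_le => i [io [x Kx xa]]; exists x.
- move=> a b ab.
  (* The apex of [a] is outside the closed cone at the apex of [b], so these
     cones have small intersection; each lower cone meets countably many
     pieces. *)
  have nUab : ~ U (b, apex) (a, apex).
    move=> [[e]|[_ [i _ Ki]]]; first by rewrite e in ab; exact: wo_ltxx ab.
    exact: (ladder_apex (L b) Ki).
  have := ladder_cone_isclosed (L _) nUab; rewrite setDE setCK => -[C [cC Ca UC]].
  apply: (@sub_countable _ _ _ (\bigcup_(c in C) [set i | K a i `&` U c !=set0])).
    apply: subset_card_le => i [j [x [[io Kix] [jo Kjx]]]].
    have xa : wo_lt (level x) a.
      have [C' [_ Cb /(_ x Kix)[c Cc Ucx]]] := ladder_small (L a) i.
      have [->|/wo_lt_trans] := ladder_cone_rank Ucx; first exact: Cb.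
      by apply; exact: Cb.
    have [|c Cc Ucx] := UC x; last by exists c => //; exists x.
    split; right; split => //.
    + by exists i.
    + exact: wo_lt_trans xa ab.
    + by exists j.
  by apply: bigcup_countable => // c /Ca; exact: (ladder_locally_countable (L a)).
Qed.

(** * Gluing copies along almost disjoint families *)

Section gluing.
Variables (kappa : omega2 -> cardinal) (Idx : Type).
Variables (V : omega2 -> set Idx) (ad : forall b, kappa b -> omega1 -> Idx).
Hypothesis V_decr : forall a b i, wo_lt a b -> V b i -> V a i.
Hypothesis ad_inj : forall b (h : kappa b), injective (ad h).
Hypothesis ad_V : forall a b (h : kappa b) k, wo_lt a b -> V a (ad h k).
Hypothesis ad_ad : forall a b (h h' : kappa b), wo_lt a b -> h <> h' ->
  countable [set k | exists k', ad h k = ad h' k'].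
Variables (U : site -> set site) (P : omega2 -> omega1 -> set site).
Hypothesis sys : cone_system level U.
Hypothesis P_small : forall b i, small level U b (P b i).
Hypothesis P_clopen : forall b i,
  cone_open level U (P b i) /\ cone_open level U (~` P b i).
Hypothesis P_rich : forall a b, wo_lt a b ->
  ~ countable [set i | exists2 x, P b i x & level x = a].
Hypothesis P_ad : forall a b, wo_lt a b ->
  countable [set i | exists j, P a i `&` P b j !=set0].

(** Copy [i] of the system is kept at the levels [w] with [V w i].  The new
    points are the elements of [kappa b], at level [b]; the [k]-th piece of the
    apex of [b] is attached to the new point [h] in copy [ad h k]. *)
Definition pre_point : Type := (site * Idx + {b : omega2 & kappa b})%type.

Definition valid (y : pre_point) : Prop :=
  if y is inl (t, i) then V (level t) i else True.

Definition point : Type := {y : pre_point | valid y}.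

Definition rank (x : point) : omega2 :=
  match sval x with inl ti => level ti.1 | inr p => projT1 p end.

Definition pre_cone (x y : pre_point) : Prop :=
  match x, y with
  | inl (t, i), inl (t', i') => i' = i /\ U t t'
  | inl _, inr _ => False
  | inr p, inl (t', i') => exists2 k, i' = ad (projT2 p) k & P (projT1 p) k t'
  | inr p, inr p' => p' = p
  end.

Definition glued_cone (x y : point) : Prop := pre_cone (sval x) (sval y).

Local Notation C := (glued_cone : point -> set point).

Definition copy (A : set site) (i : Idx) : set point :=
  [set y | exists2 t, A t & sval y = inl (t, i)].

Lemma P_below b k t : P b k t -> wo_lt (level t) b.
Proof.
move=> Pt; have [D [_ Db /(_ t Pt)[c Dc Ucx]]] := P_small b k.
have [->|/wo_lt_trans] := cone_rank sys Ucx; first exact: Db.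
by apply; exact: Db.
Qed.

(** A cover by lower cones carries over to copy [i] as soon as the copy reaches
    up to [w]. *)
Lemma small_copy (w : omega2) (A : set site) (i : Idx) :
  (forall a, wo_lt a w -> V a i) -> small level U w A -> small rank C w (copy A i).
Proof.
move=> Vi [D [cD Dw AD]]; exists (copy D i); split.
- apply: (@sub_countable _ _ _ (sval @^-1` ((fun t => inl (t, i)) @` D))).
    by apply: subset_card_le => y [t Dt yt]; exists t; rewrite ?yt.
  apply: countable_preimage_inj.
    by move=> [y hy] [z hz] /= yz; exact: eq_exist.
  exact: card_le_trans (card_image_le _ _) cD.
- by move=> c [t Dt ct]; rewrite /rank ct; exact: Dw.
- move=> y [t /AD[c Dc Uct] yt].
  exists (exist valid (inl (c, i)) (Vi _ (Dw _ Dc))); first by exists c.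
  by rewrite /glued_cone yt.
Qed.

Lemma glued_isopen z : cone_open rank C (C z).
Proof.
move=> [[[t' i']|p'] hx]; case: z => [[[t i]|p] hz] //; rewrite /glued_cone/=.
- move=> [e Utt']; subst i'.
  apply: (@sub_small _ _ _ _ _ _ (copy (U t' `\` U t) i)); last first.
    apply: small_copy; last exact: (cone_isopen sys Utt').
    by move=> a /V_decr; apply; exact: hx.
  move=> [[[t2 i2]|p2] h2] [//= [e2 Ut2] n2]; exists t2; last by rewrite /= e2.
  by split=> // Ut; apply: n2; split.
- move=> [k e Pt]; subst i'.
  apply: (@sub_small _ _ _ _ _ _ (copy (U t' `\` P (projT1 p) k) (ad (projT2 p) k))); last first.
    apply: small_copy; last exact: (P_clopen _ _).1.
    by move=> a /V_decr; apply; exact: hx.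
  move=> [[[t2 i2]|p2] h2] [//= [e2 Ut2] n2]; exists t2; last by rewrite /= e2.
  by split=> // Ut; apply: n2; exists k.
- move=> ->; apply: sub_small (small0 _ _ _) => y [yp nyp]; exact: nyp.
Qed.

(** A new cone meets each copy in at most one piece, which is clopen.  Two new
    cones meet within countably many pieces: for different levels because
    the pieces of two apices are almost disjoint, and for the same level
    because the index sets are. *)
Lemma glued_isclosed z : cone_open rank C (~` C z).
Proof.
move=> x nzx; rewrite setDE setCK; move: x z nzx.
move=> [[[t' i']|[b' h']] hx] [[[t i]|[b h]] hz]; rewrite /= /glued_cone/= => nzx.
- have [ei|ni] := pselect (i' = i); last first.
    apply: sub_small (small0 _ _ _) => -[[[t2 i2]|p2] h2] [//= [e _] [e' _]].
    by apply: ni; rewrite -e e'.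
  apply: (@sub_small _ _ _ _ _ _ (copy (U t' `\` ~` U t) i')); last first.
    apply: small_copy; last by apply: (cone_isclosed sys) => Ut; exact: nzx.
    by move=> a /V_decr; apply; exact: hx.
  move=> [[[t2 i2]|p2] h2] [//= [e2 Ut2] [_ Ut]]; exists t2; last by rewrite /= e2.
  by split=> //; apply.
- have [[k ek]|nk] := pselect (exists k, i' = ad h k); last first.
    apply: sub_small (small0 _ _ _) => -[[[t2 i2]|p2] h2] [//= [e _] [k e' _]].
    by apply: nk; exists k; rewrite -e e'.
  apply: (@sub_small _ _ _ _ _ _ (copy (U t' `\` ~` P b k) i')); last first.
    apply: small_copy.
      by move=> a /V_decr; apply; exact: hx.
    by apply: (P_clopen _ _).2 => Pt; apply: nzx; exists k.
  move=> [[[t2 i2]|p2] h2] [//= [e2 Ut2] [k' ek' Pt]]; exists t2; last by rewrite /= e2.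
  by rewrite e2 ek in ek'; split=> //; rewrite (ad_inj ek'); apply.
- have [[k ek]|nk] := pselect (exists k, i = ad h' k); last first.
    apply: sub_small (small0 _ _ _) => -[[[t2 i2]|p2] h2] [//= [k e _] [e' _]].
    by apply: nk; exists k; rewrite -e e'.
  apply: (@sub_small _ _ _ _ _ _ (copy (P b' k) i)); last first.
    apply: small_copy; last exact: P_small.
    by move=> a ab; rewrite ek; exact: ad_V.
  move=> [[[t2 i2]|p2] h2] [//= [k' e2 Pk'] [ei _]]; exists t2; last by rewrite /= ei.
  by move: ei; rewrite e2 ek => /ad_inj <-.
- case: (wo_trichotomy b b') => [bb'|ebb|b'b].
  + apply: sub_small (small_cone (x := exist _ (inr (existT _ b h)) hz) C bb').
    by move=> y [].
  all: pose Q := [set k' | exists k, ad h' k' = ad h k /\ P b' k' `&` P b k !=set0].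
  all: apply: (@sub_small _ _ _ _ _ _ (\bigcup_(k' in Q) copy (P b' k') (ad h' k'))).
  1,3: move=> [[[t2 i2]|p2] h2] [/=]; last by move=> e1 e2; case: nzx; rewrite -e1.
  1,2: move=> [k' ek' Pk'] [k ek Pk]; exists k'; last by exists t2; rewrite //= ek'.
  1,2: by exists k; split; [rewrite -ek'|exists t2].
  all: apply: small_bigcup => [|k' _]; last first.
  1,3: by apply: small_copy; [move=> a ab; exact: ad_V|exact: P_small].
  + subst b'; have [[a ab]|nb] := pselect (exists a, wo_lt a b); last first.
      apply: sub_countable (countable0 omega1); apply: subset_card_le.
      move=> k' [k [_ [t [/P_below tb _]]]].
      by case: nb; exists (level t).
    have hh' : h' <> h by move=> e; apply: nzx; rewrite e.
    apply: sub_countable (ad_ad ab hh'); apply: subset_card_le.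
    by move=> k' [k [e _]]; exists k.
  + apply: sub_countable (P_ad b'b); apply: subset_card_le.
    by move=> k' [k [_ ne]]; exists k.
Qed.

(** Each copy sees a cone as a small set, in the sense of the copy. *)
Lemma glued_slice_small x (i : Idx) w : wo_lt (rank x) w ->
  small level U w [set t | pre_cone (sval x) (inl (t, i))].
Proof.
case: x => [[[t' i']|[b h]] hx]; rewrite /rank/= => xw.
  by apply: sub_small (small_cone U xw) => t [].
have [[k ek]|nk] := pselect (exists k, i = ad h k); last first.
  apply: sub_small (small0 _ _ _) => t [k ek _].
  by apply: nk; exists k.
apply: sub_small (small_le xw (P_small b k)) => t [k' ek'].
by rewrite ek in ek'; rewrite (ad_inj ek').
Qed.

(** Within a copy this comes from the copy.  Below a new point of level [b]
    uncountably many pieces reach level [w], and a cone of rank below [b] meets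
    countably many of them. *)
Lemma glued_rich x w : wo_lt w (rank x) ->
  ~ small rank C (rank x) (C x `&` [set y | rank y = w]).
Proof.
move=> wx [D [cD Dx CD]].
case: x wx Dx CD => [[[t i]|[b h]] hx]; rewrite /rank/= => wx Dx CD.
  apply: (cone_rich sys wx).
  apply: (@sub_small _ _ _ _ _ _
    (\bigcup_(c in D) [set t | pre_cone (sval c) (inl (t, i))])).
    move=> t' [Ut' t'w].
    have Vt' : V (level t') i.
      by have [->//|/V_decr] := cone_rank sys Ut'; apply; exact: hx.
    have [|c Dc cc] := CD (exist valid (inl (t', i)) Vt'); first by split.
    by exists c.
  apply: small_bigcup => // c Dc; apply: glued_slice_small; exact: Dx.
apply: (P_rich wx).
apply: (@sub_countable _ _ _ (\bigcup_(c in D)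
  [set k | exists2 t, P b k t & pre_cone (sval c) (inl (t, ad h k))])).
  apply: subset_card_le => k [t Pt tw].
  have Vt : V (level t) (ad h k) by apply: ad_V; rewrite tw.
  have [|c Dc cc] := CD (exist valid (inl (t, ad h k)) Vt).
    by split=> //; exists k.
  by exists c => //; exists t.
apply: bigcup_countable => // c /Dx.
case: c => [[[t i]|[b' h']] hc] /= cb.
  apply: (@sub_countable _ _ _ (ad h @^-1` [set i])).
    by apply: subset_card_le => k [t' _ [<-]].
  exact: countable_preimage_inj (@ad_inj b h) (countable1 i).
apply: (@sub_countable _ _ _
  (ad h @^-1` (ad h' @` [set k' | exists k, P b' k' `&` P b k !=set0]))).
  apply: subset_card_le => k [t Pt [k' ek Pt']]; exists k' => //=.
  by exists k, t.
apply: countable_preimage_inj (@ad_inj b h) _.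
exact: card_le_trans (card_image_le _ _) (P_ad cb).
Qed.

Lemma glued_system : cone_system rank C.
Proof.
split; [|move=> x y|exact: glued_isopen|exact: glued_isclosed|exact: glued_rich].
  by move=> [[[t i]|p] hx]; rewrite /glued_cone/=; [split=> //; exact: cone_refl sys t|].
case: x y => [[[t i]|[b h]] hx] [[[t' i']|p'] hy]; rewrite /glued_cone /rank//=.
- move=> [ei Utt']; have [et|lt_tt] := cone_rank sys Utt'; last by right.
  by left; apply: eq_exist; rewrite ei et.
- by move=> [k _ /P_below]; right.
- by move=> e; left; apply: eq_exist; rewrite e.
Qed.

Lemma glued_level_card (w : omega2) : uncountable (kappa w) ->
  V w #<= [set: kappa w] -> [set x | rank x = w] #= [set: kappa w].
Proof.
move=> kunc Vk; have kinf := uncountable_infinite kunc.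
have k1 := aleph1_le kunc.
apply/card_eqPle; split; last first.
  apply: (@card_le_inj _ _ (fun h => exist valid (inr (existT _ w h)) I)) => //.
  move=> h h' _ _ [] e.
  exact: (@existT_inj2 {classic omega2} _ _ _ _ e).
pose M : Type := ((omega1 * omega1) * V w + kappa w)%type.
pose F (m : M) : pre_point :=
  match m with inl (e, i) => inl ((w, e), val i) | inr h => inr (existT _ w h) end.
apply: (@card_le_trans _ _ _ (F @` setT)).
  apply: (@card_le_inj _ _ sval).
    move=> [[[[a e] i]|[b h]] hx]; rewrite /rank/= => aw; subst w.
      by exists (inl (e, SigSub (mem_set (hx : V a i)))).
    by exists (inr h).
  by move=> [x hx] [y hy] _ _ /= xy; exact: eq_exist.
apply: card_le_trans (card_image_le _ _) _.
apply: card_sum_le => //; apply: card_prod_le => //; first exact: card_prod_le.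
by rewrite (card_le_eql (card_setT _)).
Qed.

End gluing.

(** * Separation in LLSP spaces and the upper bound *)

(** Otherwise a neighbourhood of [x], without the levels below [v], would be a
    nonempty set with no isolated point. *)
Lemma level_dense (X : topologicalType) (W : wellOrder) (v w : W) (x : X)
    (N : set X) : scattered X -> wo_lt v w -> CB_level X w x -> nbhs x N ->
  exists2 y, N y & CB_level X v y.
Proof.
move=> /scatteredP sc vw; rewrite CB_levelE => /isolatedS nx.
rewrite nbhsE => -[B [oB Bx] BN].
have [|y [/set_mem[By ny] [M yM ME]]] :=
    sc (B `&` ~` \bigcup_(u in [set u | wo_lt u v]) CB_level X u).
  by exists x; split=> // -[u /= uv ux]; apply: nx; exists u => //; exact: wo_lt_trans uv vw.
exists y; first exact: BN.
rewrite CB_levelE; split; first exact/mem_set.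
exists (M `&` B); last by rewrite -setIA.
by apply: filterI => //; exact: open_nbhs_nbhs.
Qed.

(** The argument for compact sets, where countable intersections of open sets
    replace finite ones. *)
Lemma lindelof_separated (X : topologicalType) (L : set X) (z : X) :
  hausdorff_space X -> P_space X -> lindelof L -> ~ L z ->
  exists O G : set X,
    [/\ open O, open G, O z, L `<=` G & forall y, O y -> ~ G y].
Proof.
move=> hX PX LL nLz.
pose far (B : set X) := exists A : set X, [/\ open A, A z & forall y, A y -> ~ B y].
have [|y Ly|H [HF cH LH]] := LL [set B | open B /\ far B].
- by move=> B [].
- have zy : z != y by apply/eqP => zy; apply: nLz; rewrite zy.
  move: hX; rewrite open_hausdorff => /(_ z y zy)[[A B] /= [zA yB] [oA oB AB]].
  exists B; last exact: set_mem yB.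
  split=> //; exists A; split=> //; first exact: set_mem zA.
  by move=> t At Bt; have : (A `&` B) t by []; rewrite (eqP AB).
pose A B := if pselect (far B) is left h then sval (cid h) else setT.
have AP B : H B -> [/\ open (A B), A B z & forall y, A B y -> ~ B y].
  move=> /HF[_ fB]; rewrite /A; case: pselect => // h.
  exact: (svalP (cid h)).
exists (\bigcap_(B in A @` H) B), (\bigcup_(B in H) B); split => //.
- apply: PX; first exact: card_le_trans (card_image_le _ _) cH.
  by move=> _ [B /AP[oA _ _] <-].
- by apply: bigcup_open => B /HF[].
- by move=> _ [B /AP[_ Az _] <-].
- by move=> y Ay [B HB]; have [_ _ h] := AP B HB; apply: h; apply: Ay; exists B.
Qed.

Lemma LLSP_regular (X : topologicalType) (x : X) (V : set X) :
  LLSP X -> open V -> V x ->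
  exists K : set X, [/\ closed K, nbhs x K & K `<=` V].
Proof.
move=> [locL _ hX PX] oV Vx; have [N xN LN] := locL x.
have cN : closed N.
  rewrite -(setCK N); apply: open_closedC; rewrite openE => z nNz.
  have [O [G [oO _ Oz NG OG]]] := lindelof_separated hX PX LN nNz.
  rewrite /interior/= nbhsE; exists O => // y Oy /NG; exact: OG.
have LNV : lindelof (N `\` V).
  move=> F oF cov; have [||G [GF cG NG]] := LN (F `|` [set V]).
  - by move=> B [/oF//|->].
  - move=> y Ny; have [Vy|nVy] := pselect (V y); first by exists V => //; right.
    by have [B FB By] := cov y (conj Ny nVy); exists B => //; left.
  exists (G `&` F); split; first by move=> B [].
    by apply: sub_countable cG; apply: subset_card_le => B [].
  move=> y [/NG[B GB By] nVy]; exists B => //; split=> //.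
  by case: (GF B GB) => // BV; case: nVy; rewrite -BV.
have [|O [G [oO oG Ox NVG OG]]] := lindelof_separated hX PX LNV (z := x).
  by case.
exists (N `&` ~` G); split.
- by apply: closedI => //; exact: open_closedC.
- apply: filterI => //; rewrite nbhsE; exists O => //.
- by move=> y [Ny nGy]; apply: contrapT => nVy; apply: nGy; exact: NVG.
Qed.

(** The neighbourhood that isolates [x] in its level shrinks to a closed one by
    regularity. *)
Lemma level_isolating (X : topologicalType) (W : wellOrder) (w : W) (x : X) :
  LLSP X -> CB_level X w x ->
  exists K : set X, [/\ closed K, nbhs x K & K `&` CB_level X w `<=` [set x]].
Proof.
move=> LX; rewrite CB_levelE => -[_ [V]].
rewrite {1}nbhsE => -[B [oB Bx] BV] VE.
have [K [cK xK KB]] := LLSP_regular LX oB Bx.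
exists K; split=> // y [Ky /isolatedS yw].
by rewrite -VE; split=> //; apply: BV; exact: KB.
Qed.

(** If I-hat were at most [kappa w], the property that defines it would apply
    to a subfamily of the traces on level [v] of closed neighbourhoods that
    isolate the points of level [w], against [trace_free]. *)
Lemma cardinal_sequence_lt_Ihat (X : topologicalType) (W : wellOrder)
    (kappa : W -> cardinal) (v w : W) :
  LLSP X -> has_cardinal_sequence X kappa -> wo_lt v w ->
  card_lt (kappa w) (Ihat (kappa v) (kappa v)).
Proof.
move=> LX [_ _ cardE] vw; apply: card_lt_not_ge => Ikw.
have [_ sc _ PX] := LX.
have Kex x : exists K : set X, CB_level X w x ->
    [/\ closed K, nbhs x K & K `&` CB_level X w `<=` [set x]].
  have [xw|nxw] := pselect (CB_level X w x); last by exists set0.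
  by have [K KP] := level_isolating LX xw; exists K.
pose K x := sval (cid (Kex x)).
have KP x : CB_level X w x ->
    [/\ closed (K x), nbhs x (K x) & K x `&` CB_level X w `<=` [set x]].
  exact: (svalP (cid (Kex x))).
have : [set: CB_level X v] #<= [set: kappa v].
  by rewrite (card_le_eql (card_setT _)); have /card_eqPle[] := cardE v.
move=> /card_leTTP[f fI].
pose trace x : set (kappa v) := [set f y | y in [set y | K x (val y)]].
have trace_free x (D : set X) : CB_level X w x -> D `<=` CB_level X w ->
    countable D -> ~ D x -> ~ trace x `<=` \bigcup_(y in D) trace y.
  move=> xw Dw cD nDx tr; have [_ xK _] := KP x xw.
  have oD : open (\bigcap_(V in [set ~` K y | y in D]) V).
    apply: PX; first exact: card_le_trans (card_image_le _ _) cD.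
    by move=> _ [y /Dw/KP[cK _ _] <-]; exact: closed_openC.
  have xD : nbhs x (K x `&` \bigcap_(V in [set ~` K y | y in D]) V).
    apply: filterI => //; apply: open_nbhs_nbhs; split=> // _ [y Dy <-] Kyx.
    have [_ _ /(_ x (conj Kyx xw))/= e] := KP y (Dw y Dy).
    by apply: nDx; rewrite e.
  have [z [Kxz nz] zv] := level_dense sc vw xw xD.
  have [|y Dy [z' Kyz' /fI e]] := tr (f (SigSub (mem_set zv))).
    by exists (SigSub (mem_set zv)).
  by apply: (nz (~` K y)); [exists y|rewrite e in Kyz'].
have [e eI ew] : exists2 e : Ihat (kappa v) (kappa v) -> X,
    injective e & forall m, CB_level X w (e m).
  apply: card_le_injP; apply: card_le_trans Ikw _.
  by have /card_eqPle[] := cardE w.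
have teI : injective (trace \o e).
  move=> m m' /= tmm'; apply: contrapT => ne.
  apply: (trace_free (e m) [set e m']) => //.
  - by move=> _ ->.
  - by move=> /= /eI.
  - by rewrite bigcup_set1 tmm'.
have [||t [J [[m _ <-] JI Jnat tJ]]] :=
    (IhatP (kappa v) (kappa v)).1 ((trace \o e) @` setT).
- by apply: inj_card_eq => m m' _ _; exact: teI.
- by move=> t _; exact: card_leT.
have cJ : countable J by rewrite /countable; have /card_eqPle[] := Jnat.
apply: (trace_free (e m) (e @` ((trace \o e) @^-1` J))) => //.
- by move=> _ [m' _ <-].
- apply: card_le_trans (card_image_le _ _) _.
  exact: countable_preimage_inj.
- by move=> [m' /JI[_ ne] /eI mm']; apply: ne; rewrite mm'.
- move=> k /tJ[b Jb bk]; have [[m' _ e'] _] := JI b Jb.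
  by exists (e m'); [exists m' => //=; rewrite -e' in Jb|rewrite -e' in bk].
Qed.

(** * The cardinal sequences of LLSP spaces *)

(** Below A-hat the defining property fails, and subsets of a set of size
    aleph one that are not of that size are countable. *)
Lemma almost_disjoint_family (k m : cardinal) :
  card_lt m (Ahat k aleph1) ->
  exists ad : m -> aleph1 -> k, (forall h, injective (ad h)) /\
    forall h h', h <> h' -> countable [set i | exists j, ad h i = ad h' j].
Proof.
move=> /card_lt_not_le nA.
have /existsNP[F] : ~ Ahat_prop k aleph1 m.
  by move=> Am; apply: nA; exact: (AhatP k aleph1).2.
move=> /not_implyP[Fm /not_implyP[F1 nF]].
have [e eI eF] : exists2 e : m -> set k, injective e & forall h, F (e h).
  by apply: card_le_injP; have /card_eqPle[] := Fm.
have fex h : exists f : aleph1 -> k, injective f /\ forall i, e h (f i).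
  have [f fI fe] : exists2 f : aleph1 -> k, injective f & forall i, e h (f i).
    by apply: card_le_injP; have /card_eqPle[] := F1 _ (eF h).
  by exists f.
exists (fun h => sval (cid (fex h))); split=> [h|h h' hh'].
  exact: (svalP (cid (fex h))).1.
case: (cid (fex h)) => f [fI fe]; case: (cid (fex h')) => f' [_ fe'] /=.
apply: (@sub_countable _ _ _ (f @^-1` (e h `&` e h'))).
  by apply: subset_card_le => i [j fij]; split; [exact: fe|rewrite fij; exact: fe'].
apply: countable_preimage_inj fI _; apply: contrapT => nc; apply: nF.
exists (e h), (e h'); split=> //; first by move=> /eI.
apply: card_eq_aleph1 (F1 _ (eF h)) _ nc; exact: subIsetl.
Qed.

Lemma LLSP_of_almost_disjoint (kappa : omega2 -> cardinal) :
  (forall a, uncountable (kappa a)) ->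
  (forall a b, wo_lt a b -> card_lt (kappa b) (Ahat (kappa a) aleph1)) ->
  exists X : topologicalType, LLSP X /\ has_cardinal_sequence X kappa.
Proof.
move=> kunc kA.
have [a0 _] : exists a0 : omega2, ~ set0 a0.
  apply: uncountable_notin; last exact: countable0.
  move=> c2; apply: omega2P.1; apply: card_le_trans c2 _.
  exact/infiniteP/uncountable_infinite/uncountable_aleph1.
have [best bestP] := least_in_family kappa a0.
(* [best] is a level of least cardinality.  Indices from levels up to [best]
   suffice to provide, below each [b], a family of least cardinality; there
   are only aleph one such levels, so [V w] stays within [kappa w]. *)
pose Idx := {a : omega2 & kappa a}.
pose V (w : omega2) : set Idx := [set p | ~ wo_lt best (projT1 p) /\
  forall a, ~ wo_lt w a -> [set: kappa (projT1 p)] #<= [set: kappa a]].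
have Vdecr a b i : wo_lt a b -> V b i -> V a i.
  move=> ab [h1 h2]; split=> // c nac; apply: h2 => bc; apply: nac.
  exact: wo_lt_trans ab bc.
have Vcard w : V w #<= [set: kappa w].
  pose A := [set a | ~ wo_lt best a].
  have kinf := uncountable_infinite (kunc w).
  have Vf (p : V w) : exists f : kappa (projT1 (val p)) -> kappa w, injective f.
    by have [_ h] := set_mem (valP p); apply/card_leTTP; apply: h; exact: wo_ltxx.
  rewrite -(card_le_eql (card_setT _)).
  apply: (@card_le_trans _ _ _ [set: A * kappa w]); last first.
    apply: card_prod_le => //; rewrite (card_le_eql (card_setT _)).
    exact: card_le_trans (card_le_initial best) (aleph1_le (kunc w)).
  have fex a : exists f : kappa a -> kappa w,
      [set: kappa a] #<= [set: kappa w] -> injective f.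
    have [/card_leTTP[f fI]|nle] := pselect ([set: kappa a] #<= [set: kappa w]).
      by exists f.
    have [x _] := uncountable_notin (kunc w) (countable0 _).
    by exists (fun=> x).
  pose f a := sval (cid (fex a)).
  have fI a : [set: kappa a] #<= [set: kappa w] -> injective (f a).
    exact: (svalP (cid (fex a))).
  apply/card_leTTP.
  exists (fun p : V w => (SigSub (mem_set ((set_mem (valP p)).1 : A (projT1 (val p)))),
                          f _ (projT2 (val p)))).
  move=> [[a x] hp] [[b y] hq] /= [ab fxy]; apply: val_inj => /=; subst b.
  congr existT; apply: (fI a) fxy; apply: (set_mem hp).2; exact: wo_ltxx.
have adex b : exists ad : kappa b -> omega1 -> Idx,
    [/\ forall h, injective (ad h), forall a h k, wo_lt a b -> V a (ad h k) &
    forall a h h', wo_lt a b -> h <> h' ->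
      countable [set k | exists k', ad h k = ad h' k']].
  have existI a : injective (existT kappa a).
    by move=> x y; exact: (@existT_inj2 {classic omega2}).
  have [[c cb]|nb] := pselect (exists c, wo_lt c b); last first.
    (* On the bottom level the new points are isolated and the pieces are
       empty, so all of them may use the same copies. *)
    have /card_leTTP[f fI] := aleph1_le (kunc b).
    exists (fun _ k => existT kappa b (f k)); split.
    - by move=> _ k k' /existI/fI.
    - by move=> a h k ab; case: nb; exists a.
    - by move=> a h h' ab; case: nb; exists a.
  have [a [nba ab amin]] : exists a, [/\ ~ wo_lt best a, wo_lt a b &
      forall a', wo_lt a' b -> [set: kappa a] #<= [set: kappa a']].
    have [[a ab] amin] := @least_in_family {a | wo_lt a b}
      (fun i => kappa (sval i)) (exist _ c cb).
    have [besta|nba] := pselect (wo_lt best a).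
      exists best; split=> //; first exact: wo_ltxx.
      exact: wo_lt_trans besta ab.
    by exists a; split=> // a' a'b; exact: (amin (exist _ a' a'b)).
  have [ad [adI adad]] := almost_disjoint_family (kA a b ab).
  exists (fun h k => existT kappa a (ad h k)); split.
  - by move=> h k k' /existI/adI.
  - move=> a' h k a'b; split=> //= d na'd; apply: amin.
    by case: (wo_trichotomy a' d) => [//|<-//|da']; exact: wo_lt_trans da' a'b.
  - move=> a' h h' _ hh'; apply: sub_countable (adad h h' hh').
    by apply: subset_card_le => k [k' /existI e]; exists k'.
pose ad b := sval (cid (adex b)).
have adP b := svalP (cid (adex b)).
have [U [P [sys Psmall Pclopen Prich Pad]]] := thin_tall_system.
have gsys : cone_system (@rank kappa Idx V) (glued_cone (V := V) ad U P).
  apply: glued_system => //.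
  - by move=> b h; have [adI _ _] := adP b; exact: adI.
  - by move=> a b h k ab; have [_ adV _] := adP b; exact: adV.
  - by move=> a b h h' ab; have [_ _ adad] := adP b; exact: adad ab.
exists (cone_space (@rank kappa Idx V) (glued_cone (V := V) ad U P)).
split; first exact: cone_space_LLSP.
apply: cone_space_cardinal_sequence => // w; first exact: uncountable_infinite.
by apply: glued_level_card.
Qed.

Theorem theorem4p4 (kappa : omega2 -> cardinal)
    (kappa_unc : forall a : omega2, uncountable (kappa a)) :
  ((forall a b : omega2, wo_lt a b ->
      card_lt (kappa b) (Ahat (kappa a) aleph1)) ->
   exists X : topologicalType, LLSP X /\ has_cardinal_sequence X kappa) /\
  ((exists X : topologicalType, LLSP X /\ has_cardinal_sequence X kappa) ->
   forall a b : omega2, wo_lt a b ->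
     card_lt (kappa b) (Ihat (kappa a) (kappa a))).
Proof.
split; first exact: LLSP_of_almost_disjoint.
by move=> [X [LX kX]] a b; exact: cardinal_sequence_lt_Ihat LX kX.
Qed.
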